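(* Let $d\in\mathbb{N}$ with $d\ge 1$, and let $R$ be a $d$-ary relation symbol. There exists a first-order formula $\nu'_d(x)$ over the vocabulary $\{+,<,R\}$, with one free variable $x$ (depending only on $d$ and not on the interpretation of $R$), such that for every $\{+,<,R\}$-structure $\mathcal{S}$ over $\mathbb{N}$: if $R^{\mathcal{S}}\subseteq\mathbb{N}^d$ is not $\mathrm{FO}[\mathbb{N},+,<]$-definable, then the set $\nu'_d(x)^{\mathcal{S}}\subseteq\mathbb{N}$ is expanding.
   Context: $\mathbb{N}$ is the set of non-negative integers. All structures have universe $\mathbb{N}$, and the symbols $+$ and $<$ always have their standard interpretation on $\mathbb{N}$ (addition as a binary function, the usual strict order); thus a $\{+,<,R\}$-structure $\mathcal{S}$ is determined by the interpretation $R^{\mathcal{S}}\subseteq\mathbb{N}^d$ of the $d$-ary relation symbol $R$, which is arbitrary. First-order logic is with equality. Formulas have no parameters. For a formula $\phi(x_0,\dots,x_{d-1})$, the set it defines in $\mathcal{S}$ is $\phi(x_0,\dots,x_{d-1})^{\mathcal{S}}=\{(n_0,\dots,n_{d-1})\in\mathbb{N}^d : \mathcal{S}\models\phi(n_0,\dots,n_{d-1})\}$. A subset of $\mathbb{N}^d$ is $\mathrm{FO}[\mathbb{N},+,<]$-definable if it is defined by some first-order formula over the vocabulary $\{+,<\}$ in $(\mathbb{N},+,<)$. A set $A\subseteq\mathbb{N}$ is expanding if it is infinite and the distance between two successive elements of $A$ is not bounded. *)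

(* Defs.v *)
From mathcomp Require Import all_boot.
From mathcomp Require Import boolp classical_sets functions cardinality.

Set Implicit Arguments.
Unset Strict Implicit.
Unset Printing Implicit Defensive.

Local Open Scope classical_set_scope.

(* First-order logic over the symbols [+] and [<], always interpreted in the
   standard way on [nat], together with further relation symbols. *)
Record vocabulary := Vocabulary {
  symbol : Type;
  arity : symbol -> nat
}.

Definition plus_lt : vocabulary := @Vocabulary void (@of_void nat).
Definition plus_lt_rel (d : nat) : vocabulary := @Vocabulary unit (fun=> d).

(* [term n] and [formula V n] have their free variables among [x_0], ...,
   [x_{n-1}], and no parameters.  A quantifier binds the variable of index 0 of
   its body and shifts the others by one (de Bruijn indices). *)
Inductive term (n : nat) : Type :=
| Var of 'I_n
| Add of term n & term n.

Inductive formula (V : vocabulary) (n : nat) : Type :=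
| Eq of term n & term n
| Lt of term n & term n
| Rel (r : symbol V) of (arity r).-tuple (term n)
| Not of formula V n
| And of formula V n & formula V n
| Or of formula V n & formula V n
| Imp of formula V n & formula V n
| Ex of formula V n.+1
| All of formula V n.+1.

Definition structure (V : vocabulary) : Type :=
  forall r : symbol V, set ((arity r).-tuple nat).

Definition standard_model : structure plus_lt :=
  fun r => match r with end.

Fixpoint eval n (v : n.-tuple nat) (t : term n) : nat :=
  match t with
  | Var i => tnth v i
  | Add t1 t2 => eval v t1 + eval v t2
  end.

Fixpoint sat V (S : structure V) n (v : n.-tuple nat) (phi : formula V n)
    {struct phi} : Prop :=
  match phi in formula _ _ with
  | Eq t1 t2 => eval v t1 = eval v t2
  | Lt t1 t2 => eval v t1 < eval v t2
  | Rel r ts => S r (map_tuple (eval v) ts)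
  | Not p => ~ sat S v p
  | And p q => sat S v p /\ sat S v q
  | Or p q => sat S v p \/ sat S v q
  | Imp p q => sat S v p -> sat S v q
  | Ex p => exists a : nat, sat S (cons_tuple a v) p
  | All p => forall a : nat, sat S (cons_tuple a v) p
  end.

Definition defined_set V (S : structure V) n (phi : formula V n) :
    set (n.-tuple nat) :=
  [set v | sat S v phi].

(* The case of one free variable, with [nat ^ 1] identified with [nat]. *)
Definition defined_set1 V (S : structure V) (phi : formula V 1) : set nat :=
  [set a | defined_set S phi [tuple a]].

Definition FO_plus_lt_definable d (A : set (d.-tuple nat)) : Prop :=
  exists phi : formula plus_lt d, defined_set standard_model phi = A.

Definition successive (A : set nat) (a b : nat) : Prop :=
  [/\ A a, A b, a < b & forall c, a < c < b -> ~ A c].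

Definition expanding (A : set nat) : Prop :=
  infinite_set A /\
  ~ (exists B : nat, forall a b, successive A a b -> b - a <= B).

(* Main.v *)
Require Import Defs.
From mathcomp Require Import all_boot all_order all_algebra.
From mathcomp Require Import boolp classical_sets functions cardinality.
From mathcomp Require Import zify ring.

(** Call a property of structures forced if some formula nu(x) defines an
    expanding set in every structure that violates the property.  The goal is
    that definability of the relation R is forced.  Forced properties are closed
    under consequence, under finite conjunction (being expanding is first-order,
    so a formula can select the first of two sets that is expanding) and under
    quantification over a natural parameter (a formula can select the least
    parameter that violates the property).  Hence it is enough to derive the
    definability of R from the assumption that finitely many explicit sets
    A(.; c), written uniformly in R and in the parameters c, are not expanding.

    Dimension one.  If A is a definable set of numbers, then it is forced to be
    ultimately periodic ([forced_ultimate_period]).  Otherwise every set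
    D_p = {x | A(x) and A(x + p) differ} is infinite; let w_n be the
    lexicographically least word of length n that occurs infinitely often in A.
    The w_n are prefixes of one another, so the first occurrences of w_n after n
    increase with n; two of them at bounded distance p would make A locally
    p-periodic on a long interval and so make D_p expanding.  Moreover a definable
    family of such sets has a common period ([forced_uniform_ultimate_period]): the least
    common periods of its finite subfamilies divide one another, so infinitely
    many values would form an expanding set.

    Local periodicity ([forced_locally_periodic]).  There is a K such that for
    every k, around every far enough x, R is invariant on a cube of side k under
    some nonzero translation w with coordinates at most K.  Otherwise let x_l be
    the first point of norm at least l around which this fails.  All the sets
    {l | R(x_l + y)} and those comparing the coordinates of x_l and x_(l+q) have
    a common period p, which does not depend on K or k.  For K = p and l a large
    multiple of p, w = x_(l+p) - x_l is then a small nonzero translation which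
    preserves R around x_l.

    From local periodicity to definability
    ([presburger_of_locally_periodic]).  View the characteristic function of R as a
    power series F over the field with two elements.  Local periodicity says
    that the product of F by all the binomials 1 + X^w, for w nonzero with
    coordinates at most K, is supported on finitely many hyperplanes x_i = c.  There
    it is computed from the sections of R, which are definable by induction on
    the dimension.  It remains to divide by the binomials: dividing by 1 + X^w
    amounts to counting modulo 2 the points of a definable set on a half-line
    of direction -w ([qf_integrate]). *)

Set Implicit Arguments.
Unset Strict Implicit.
Unset Printing Implicit Defensive.

(** * Predicates expressible by one formula in all structures *)

Notation env := (nat -> nat).

Definition scons (a : nat) (r : env) : env :=
  fun k => if k is k'.+1 then r k' else a.

Infix ".:" := scons (at level 60, right associativity).

Definition prefix_tuple (r : env) N : N.-tuple nat := [tuple r i | i < N].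

(** Environments are infinite, so that predicates with different numbers of
    free variables need no casts; a formula sees a finite prefix. *)
Definition expressible V (P : structure V -> env -> Prop) : Prop :=
  exists N (phi : formula V N), forall S r, P S r <-> sat S (prefix_tuple r N) phi.

Lemma expressible_ext V (P Q : structure V -> env -> Prop) :
  (forall S r, P S r <-> Q S r) -> expressible P -> expressible Q.
Proof. by move=> H [N [phi phiP]]; exists N, phi => S r; rewrite -H phiP. Qed.

Fixpoint ren_term n m (f : 'I_n -> 'I_m) (t : term n) : term m :=
  match t with
  | Var i => Var (f i)
  | Add t1 t2 => Add (ren_term f t1) (ren_term f t2)
  end.

Definition up_ren n m (f : 'I_n -> 'I_m) (i : 'I_n.+1) : 'I_m.+1 :=
  oapp (fun j => lift ord0 (f j)) ord0 (unlift ord0 i).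

Fixpoint ren V n m (f : 'I_n -> 'I_m) (phi : formula V n) {struct phi} :
    formula V m :=
  match phi with
  | Eq t1 t2 => Eq V (ren_term f t1) (ren_term f t2)
  | Lt t1 t2 => Lt V (ren_term f t1) (ren_term f t2)
  | Rel r ts => Rel (map_tuple (ren_term f) ts)
  | Not p => Not (ren f p)
  | And p q => And (ren f p) (ren f q)
  | Or p q => Or (ren f p) (ren f q)
  | Imp p q => Imp (ren f p) (ren f q)
  | Ex p => Ex (ren (up_ren f) p)
  | All p => All (ren (up_ren f) p)
  end.

Definition pull n m (f : 'I_n -> 'I_m) (v : m.-tuple nat) : n.-tuple nat :=
  [tuple tnth v (f i) | i < n].

Lemma eval_ren n m (f : 'I_n -> 'I_m) v t :
  eval v (ren_term f t) = eval (pull f v) t.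
Proof. by elim: t => [i|t1 IH1 t2 IH2] /=; rewrite ?tnth_mktuple ?IH1 ?IH2. Qed.

Lemma pull_cons n m (f : 'I_n -> 'I_m) a v :
  pull (up_ren f) (cons_tuple a v) = cons_tuple a (pull f v).
Proof.
apply: eq_from_tnth => i; rewrite tnth_mktuple /up_ren.
case: unliftP => [j|] -> /=; last by rewrite !tnth0.
by rewrite !tnthS tnth_mktuple.
Qed.

Lemma sat_ren V (S : structure V) n m (f : 'I_n -> 'I_m) v phi :
  sat S v (ren f phi) = sat S (pull f v) phi.
Proof.
elim: phi m f v => {n} [n t1 t2|n t1 t2|n r ts|n p IH|n p IHp q IHq
  |n p IHp q IHq|n p IHp q IHq|n p IH|n p IH] m f v /=.
- by rewrite !eval_ren.
- by rewrite !eval_ren.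
- congr (S r _); apply: eq_from_tnth => i.
  by rewrite !tnth_map eval_ren.
- by rewrite IH.
- by rewrite IHp IHq.
- by rewrite IHp IHq.
- by rewrite IHp IHq.
- by under eq_exists => a do rewrite IH pull_cons.
- by under eq_forall => a do rewrite IH pull_cons.
Qed.

Section Expressible.
Variable V : vocabulary.
Implicit Types P Q : structure V -> env -> Prop.

Lemma expressible_ren P (h : nat -> nat) :
  expressible P -> expressible (fun S r => P S (fun k => r (h k))).
Proof.
case=> N [phi phiP]; pose M := (\max_(i < N) h i).+1.
have hM (i : 'I_N) : h i < M by rewrite ltnS (leq_bigmax i).
exists M, (ren (fun i : 'I_N => Ordinal (hM i)) phi) => S r.
rewrite phiP sat_ren; set t := prefix_tuple _ _; set t' := pull _ _.
by have -> : t = t' by apply: eq_from_tnth => i; rewrite !tnth_mktuple.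
Qed.

Lemma expressible_widen P : expressible P ->
  exists N, forall M, N <= M -> exists phi : formula V M,
    forall S r, P S r <-> sat S (prefix_tuple r M) phi.
Proof.
case=> N [phi phiP]; exists N => M leNM.
exists (ren (widen_ord leNM) phi) => S r.
rewrite phiP sat_ren; set t := prefix_tuple _ _; set t' := pull _ _.
by have -> : t = t' by apply: eq_from_tnth => i; rewrite !tnth_mktuple.
Qed.

Lemma expressible2 P Q : expressible P -> expressible Q ->
  exists N (phi psi : formula V N), forall S r,
    (P S r <-> sat S (prefix_tuple r N) phi) /\
    (Q S r <-> sat S (prefix_tuple r N) psi).
Proof.
move=> /expressible_widen[N HN] /expressible_widen[M HM].
have [phi phiP] := HN _ (leq_maxl N M); have [psi psiP] := HM _ (leq_maxr N M).
by exists (maxn N M), phi, psi => S r; split.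
Qed.

Lemma expressible_not P : expressible P -> expressible (fun S r => ~ P S r).
Proof. by case=> N [phi phiP]; exists N, (Not phi) => S r /=; rewrite phiP. Qed.

Lemma expressible_and P Q : expressible P -> expressible Q ->
  expressible (fun S r => P S r /\ Q S r).
Proof.
move=> dP dQ; have [N [phi [psi H]]] := expressible2 dP dQ.
by exists N, (And phi psi) => S r /=; have [-> ->] := H S r.
Qed.

Lemma expressible_or P Q : expressible P -> expressible Q ->
  expressible (fun S r => P S r \/ Q S r).
Proof.
move=> dP dQ; have [N [phi [psi H]]] := expressible2 dP dQ.
by exists N, (Or phi psi) => S r /=; have [-> ->] := H S r.
Qed.

Lemma expressible_imp P Q : expressible P -> expressible Q ->
  expressible (fun S r => P S r -> Q S r).
Proof.
move=> dP dQ; have [N [phi [psi H]]] := expressible2 dP dQ.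
by exists N, (Imp phi psi) => S r /=; have [-> ->] := H S r.
Qed.

Lemma expressible_iff P Q : expressible P -> expressible Q ->
  expressible (fun S r => P S r <-> Q S r).
Proof. by move=> dP dQ; apply: expressible_and; apply: expressible_imp. Qed.

Lemma prefix_tuple_cons a r N :
  prefix_tuple (a .: r) N.+1 = cons_tuple a (prefix_tuple r N).
Proof.
apply: eq_from_tnth => i; rewrite tnth_mktuple.
by case: (unliftP ord0 i) => [j|] ->; rewrite ?tnth0 // tnthS tnth_mktuple.
Qed.

Lemma scons_eta (r : env) : r 0 .: (fun k => r k.+1) = r.
Proof. by apply: funext => -[]. Qed.

Lemma expressible_ex (Q : structure V -> nat -> env -> Prop) :
  expressible (fun S r => Q S (r 0) (fun k => r k.+1)) ->
  expressible (fun S r => exists a, Q S a r).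
Proof.
case/expressible_widen=> N /(_ N.+1 (leqnSn N))[phi phiP].
exists N, (Ex phi) => S r /=; split=> -[a Ha]; exists a;
  by move: Ha; rewrite -prefix_tuple_cons -phiP.
Qed.

Lemma expressible_all (Q : structure V -> nat -> env -> Prop) :
  expressible (fun S r => Q S (r 0) (fun k => r k.+1)) ->
  expressible (fun S r => forall a, Q S a r).
Proof.
case/expressible_widen=> N /(_ N.+1 (leqnSn N))[phi phiP].
exists N, (All phi) => S r /=.
by split=> H a; move: (H a); rewrite -prefix_tuple_cons -phiP.
Qed.

Lemma expressible_var_lt i j : expressible (fun (S : structure V) r => r i < r j).
Proof.
have H : expressible (fun (S : structure V) r => r 0 < r 1).
  exists 2, (Lt V (Var ord0) (Var ord_max)) => S r /=.
  by rewrite !tnth_mktuple.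
by have := expressible_ren (fun k => if k is 0 then i else j) H.
Qed.

Lemma expressible_var_eq i j : expressible (fun (S : structure V) r => r i = r j).
Proof.
have H : expressible (fun (S : structure V) r => r 0 = r 1).
  exists 2, (Eq V (Var ord0) (Var ord_max)) => S r /=.
  by rewrite !tnth_mktuple.
by have := expressible_ren (fun k => if k is 0 then i else j) H.
Qed.

Lemma expressible_var_add i j l :
  expressible (fun (S : structure V) r => r i = r j + r l).
Proof.
have H : expressible (fun (S : structure V) r => r 0 = r 1 + r 2).
  exists 3, (Eq V (Var ord0) (Add (Var (inord 1)) (Var ord_max))) => S r /=.
  by rewrite !tnth_mktuple /= inordK.
by have := expressible_ren (fun k => if k is k'.+1 then if k' is 0 then j else l else i) H.
Qed.

(** The graph of [f] is expressible, the value being variable 0. *)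
Definition expressible_fun (f : env -> nat) : Prop :=
  expressible (fun (S : structure V) r => r 0 = f (fun k => r k.+1)).

Lemma expressible_let P f : expressible P -> expressible_fun f ->
  expressible (fun S r => P S (f r .: r)).
Proof.
move=> dP df.
have -> : (fun S r => P S (f r .: r)) =
    (fun S r => exists a, a = f r /\ P S (a .: r)).
  apply: funext => S; apply: funext => r; apply: propext.
  by split=> [?|[a [-> //]]]; exists (f r).
apply: expressible_ex; apply: expressible_and => //.
by under eq_fun do under eq_fun do rewrite scons_eta.
Qed.

Lemma expressible_fun_ren f (h : nat -> nat) :
  expressible_fun f -> expressible_fun (fun r => f (fun k => r (h k))).
Proof.
exact: (expressible_ren (fun k => if k is k'.+1 then (h k').+1 else 0)).
Qed.

Lemma expressible_var i : expressible_fun (fun r => r i).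
Proof. exact: expressible_var_eq. Qed.

(** Simultaneous substitution, obtained by replacing the variables of the
    formula of [P] one at a time with [expressible_let]. *)
Lemma expressible_app P (e : env -> env) : expressible P ->
  (forall k, expressible_fun (fun r => e r k)) ->
  expressible (fun S r => P S (e r)).
Proof.
move=> dP de.
have H n : forall f : nat -> env -> nat, (forall k, expressible_fun (f k)) ->
    expressible (fun S r => P S (fun k => if k < n then f k r else r (k - n))).
  elim: n => [|n IH] f df.
    by under eq_fun do under eq_fun do under eq_fun do rewrite subn0.
  have := IH (fun k r => f k (fun j => r j.+1)).
  case/(_ _)/Wrap => [k|]; first exact: (expressible_fun_ren succn).
  move=> /expressible_let /(_ (df n)) /=.
  congr expressible; apply: funext => S; apply: funext => r; congr (P S _).
  apply: funext => k; case: (ltngtP k n) => [kn|kn|->] /=.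
  - by rewrite ltnS (ltnW kn).
  - by rewrite ltnS leqNgt kn /= -[k - n]prednK ?subn_gt0 //= subnS.
  - by rewrite subnn ltnSn.
have [N [phi phiP]] := dP.
suff -> : (fun S r => P S (e r)) =
    (fun S r => P S (fun k => if k < N then e r k else r (k - N))).
  by apply: (H N (fun k r => e r k)).
apply: funext => S; apply: funext => r; apply: propext; rewrite !phiP.
suff -> : prefix_tuple (e r) N =
  prefix_tuple (fun k => if k < N then e r k else r (k - N)) N by [].
by apply: eq_from_tnth => i; rewrite !tnth_mktuple ltn_ord.
Qed.

End Expressible.

Section ExpressibleFun.
Variable V : vocabulary.
Implicit Types P Q : structure V -> env -> Prop.
Implicit Types f g : env -> nat.

Lemma expressible_scons f (e : env -> env) : expressible_fun V f ->
  (forall k, expressible_fun V (fun r => e r k)) ->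
  forall k, expressible_fun V (fun r => (f r .: e r) k).
Proof. by move=> df de [|k] /=. Qed.

Lemma expressible_shift f :
  expressible_fun V f -> expressible_fun V (fun r => f (fun k => r k.+1)).
Proof. exact: (expressible_fun_ren succn). Qed.

Lemma expressible_add f g : expressible_fun V f -> expressible_fun V g ->
  expressible_fun V (fun r => f r + g r).
Proof.
move=> df dg; rewrite /expressible_fun.
apply: (@expressible_app _ _ (fun r => f (fun k => r k.+1) .:
  (g (fun k => r k.+1) .: r)) (expressible_var_add V 2 0 1)).
do 2![apply: expressible_scons; first exact: expressible_shift].
exact: expressible_var.
Qed.

Lemma expressible_lt f g : expressible_fun V f -> expressible_fun V g ->
  expressible (fun (S : structure V) r => f r < g r).
Proof.
move=> df dg.
apply: (@expressible_app _ _ (fun r => f r .: (g r .: r)) (expressible_var_lt V 0 1)).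
do 2![apply: expressible_scons => //]; exact: expressible_var.
Qed.

Lemma expressible_eq f g : expressible_fun V f -> expressible_fun V g ->
  expressible (fun (S : structure V) r => f r = g r).
Proof.
move=> df dg.
apply: (@expressible_app _ _ (fun r => f r .: (g r .: r)) (expressible_var_eq V 0 1)).
do 2![apply: expressible_scons => //]; exact: expressible_var.
Qed.

Lemma expressible_le f g : expressible_fun V f -> expressible_fun V g ->
  expressible (fun (S : structure V) r => f r <= g r).
Proof.
move=> df dg; apply: (@expressible_ext _ (fun S r => ~ g r < f r)).
  by move=> S r; lia.
by apply: expressible_not; apply: expressible_lt.
Qed.

Lemma expressible_const c : expressible_fun V (fun=> c).
Proof.
elim: c => [|c IH].
  by apply: expressible_ext (expressible_var_add V 0 0 0) => S r; split; lia.
apply: (@expressible_ext _ (fun S r => c < r 0 /\ forall a, c < a -> ~ a < r 0)).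
  move=> S r; split; last by move=> ->; split=> // a; lia.
  by move=> [h1 /(_ c.+1)]; lia.
apply: expressible_and; first by apply: expressible_lt => //; exact: expressible_var.
apply: expressible_all; apply: expressible_imp.
  by apply: expressible_lt => //; exact: expressible_var.
by apply: expressible_not; apply: expressible_lt; exact: expressible_var.
Qed.

Lemma expressible_sum (I : Type) (s : seq I) (f : I -> env -> nat) :
  (forall i, expressible_fun V (f i)) ->
  expressible_fun V (fun r => \sum_(i <- s) f i r).
Proof.
move=> df; elim: s => [|i s IH].
  by under [X in expressible_fun _ X]eq_fun do rewrite big_nil;
    exact: expressible_const.
under [X in expressible_fun _ X]eq_fun do rewrite big_cons.
exact: expressible_add.
Qed.

Lemma expressible_mul c f : expressible_fun V f ->
  expressible_fun V (fun r => c * f r).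
Proof.
move=> df; elim: c => [|c IH]; first exact: expressible_const.
under [X in expressible_fun _ X]eq_fun do rewrite mulSn.
exact: expressible_add.
Qed.

Lemma expressible_true (A : Prop) : expressible (fun (_ : structure V) _ => A).
Proof.
case: (pselect A) => HA.
  by apply: expressible_ext (expressible_var_eq V 0 0).
by apply: expressible_ext (expressible_var_lt V 0 0) => S r; rewrite ltnn.
Qed.

Lemma expressible_fin_all (I : finType) (P : I -> structure V -> env -> Prop) :
  (forall i, expressible (P i)) ->
  expressible (fun S r => forall i, P i S r).
Proof.
move=> dP.
have H (s : seq I) : expressible (fun S r => forall i, i \in s -> P i S r).
  elim: s => [|i s IH]; first by apply: expressible_ext (expressible_true True).
  apply: expressible_ext (expressible_and (dP i) IH) => S r; split.
    by move=> [K1 K2] j; rewrite inE => /orP[/eqP->|/K2].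
  by move=> K; split=> [|j js]; apply: K; rewrite inE ?eqxx ?js ?orbT.
apply: expressible_ext (H (enum I)) => S r.
by split=> [K i|K i _ //]; apply: K; rewrite mem_enum.
Qed.

Lemma expressible_fin_ex (I : finType) (P : I -> structure V -> env -> Prop) :
  (forall i, expressible (P i)) ->
  expressible (fun S r => exists i, P i S r).
Proof.
move=> dP; apply: (@expressible_ext _ (fun S r => ~ forall i, ~ P i S r)).
  move=> S r; split=> [H|[i Pi] /(_ i) //].
  by apply: contrapT => nP; apply: H => i Pi; apply: nP; exists i.
by apply: expressible_not; apply: expressible_fin_all => i; exact: expressible_not.
Qed.

End ExpressibleFun.

(** A vector of variables is stored in an environment as its first [d] entries. *)
Definition vapp d (x : 'I_d -> nat) (r : env) : env :=
  fun k => if insub k is Some i then x i else r (k - d).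

Lemma vappL d (x : 'I_d -> nat) r (i : 'I_d) : vapp x r i = x i.
Proof. by rewrite /vapp valK. Qed.

Lemma vappR d (x : 'I_d -> nat) r k : vapp x r (d + k) = r k.
Proof. by rewrite /vapp insubF ?addKn // ltnNge leq_addr. Qed.

Section Vectors.
Variable V : vocabulary.

Lemma expressible_vapp d (x : env -> 'I_d -> nat) (e : env -> env) :
  (forall i, expressible_fun V (fun r => x r i)) ->
  (forall k, expressible_fun V (fun r => e r k)) ->
  forall k, expressible_fun V (fun r => vapp (x r) (e r) k).
Proof. by move=> dx de k; rewrite /vapp; case: insubP => [i _ _|_]. Qed.

Definition insert_coord d (h : 'I_d.+1) a (x : 'I_d -> nat) : 'I_d.+1 -> nat :=
  fun i => if unlift h i is Some j then x j else a.

Lemma insert_coord_eta d (h : 'I_d.+1) (x : 'I_d.+1 -> nat) :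
  x = insert_coord h (x h) (fun i => x (lift h i)).
Proof.
by apply: funext => i; rewrite /insert_coord; case: unliftP => [j|] ->.
Qed.

Lemma vapp_insert_coord0 d a (x : 'I_d -> nat) r : vapp (insert_coord ord0 a x) r = a .: vapp x r.
Proof.
apply: funext => -[|k] /=.
  by rewrite -[0]/(val (@ord0 d)) vappL /insert_coord unlift_none.
rewrite /vapp; case: insubP => [i|] /=; last first.
  by rewrite ltnS => /negbTE kd; rewrite insubF.
rewrite ltnS => kd ik; rewrite insubT /insert_coord.
have -> : i = lift ord0 (Ordinal kd) by apply: val_inj; rewrite /= /bump /= add1n -ik.
by rewrite liftK; congr (x _); apply: val_inj.
Qed.

Lemma expressible_vex0 d (P : structure V -> env -> Prop) : expressible P ->
  expressible (fun S r => exists x : 'I_d -> nat, P S (vapp x r)).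
Proof.
elim: d P => [|d IH] P dP.
  rewrite (_ : (fun _ => _) = P) //.
  apply: funext => S; apply: funext => r; apply: propext.
  have E (x : 'I_0 -> nat) : vapp x r = r.
    by apply: funext => k; rewrite /vapp insubF ?subn0.
  split=> [[x]|Pr]; first by rewrite E.
  by exists (fun=> 0); rewrite E.
have := expressible_ex (Q := fun S a r => exists x : 'I_d -> nat, P S (a .: vapp x r)).
rewrite (_ : (fun S r => exists a x, _) =
  (fun S r => exists x : 'I_d.+1 -> nat, P S (vapp x r))).
  apply.
  (* coordinate 0, bound outside, is variable d under the inner quantifiers *)
  rewrite (_ : (fun _ => _) = fun S r => exists x : 'I_d -> nat,
     (fun S r' => P S (r' d .: (fun k => if k < d then r' k else r' k.+1))) S (vapp x r)).
    apply: (IH (fun S r' => P S (r' d .: (fun k => if k < d then r' k else r' k.+1)))).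
    apply: (expressible_app
      (e := fun r' => r' d .: (fun k => if k < d then r' k else r' k.+1)) dP).
    apply: expressible_scons; first exact: expressible_var.
    by move=> k; case: (k < d); exact: expressible_var.
  apply: funext => S; apply: funext => r; apply: eq_exists => x.
  have -> : vapp x r d = r 0 by have := vappR x r 0; rewrite addn0.
  congr (P S (_ .: _)).
  apply: funext => k; case: ltnP => kd.
    by rewrite /vapp; case: insubP => //; rewrite kd.
  by rewrite /vapp !insubF ?subSn // ltnNge ?kd // (leq_trans kd).
apply: funext => S; apply: funext => r; apply: propext; split.
  by move=> [a [x Px]]; exists (insert_coord ord0 a x); rewrite vapp_insert_coord0.
move=> [x]; rewrite (insert_coord_eta ord0 x) vapp_insert_coord0 => Px.
by exists (x ord0), (fun i => x (lift ord0 i)).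
Qed.

Lemma expressible_vex d (Q : structure V -> ('I_d -> nat) -> env -> Prop) :
  expressible (fun S r => Q S (fun i => r i) (fun k => r (d + k))) ->
  expressible (fun S r => exists x, Q S x r).
Proof.
move=> /(expressible_vex0 d); congr expressible.
apply: funext => S; apply: funext => r; apply: eq_exists => x; congr (Q S _ _).
  by apply: funext => i; rewrite vappL.
by apply: funext => i; rewrite vappR.
Qed.

Lemma expressible_vall d (Q : structure V -> ('I_d -> nat) -> env -> Prop) :
  expressible (fun S r => Q S (fun i => r i) (fun k => r (d + k))) ->
  expressible (fun S r => forall x, Q S x r).
Proof.
move=> dQ; rewrite (_ : (fun _ => _) = fun S r => ~ exists x, ~ Q S x r).
  by apply: expressible_not; apply: expressible_vex; apply: expressible_not.
apply: funext => S; apply: funext => r; apply: propext; split.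
  by move=> H [x]; apply.
by move=> H x; apply: contrapT => nQ; apply: H; exists x.
Qed.

End Vectors.

(** * Expanding sets and the properties they force *)

Lemma ex_least (A : nat -> Prop) : (exists n, A n) ->
  exists n, A n /\ forall m, A m -> n <= m.
Proof.
move=> [n]; elim/ltn_ind: n => n IH An.
case: (pselect (exists m, m < n /\ A m)) => [[m [mn Am]]|H]; first exact: IH Am.
by exists n; split=> // m Am; rewrite leqNgt; apply/negP => mn; apply: H; exists m.
Qed.

Lemma ex_greatest (A : nat -> Prop) N : (exists n, A n) ->
  (forall n, A n -> n <= N) ->  exists n, A n /\ forall m, A m -> m <= n.
Proof.
move=> [n An] ub.
have [|k [[m [Am <-]] H]] := @ex_least (fun k => exists m, A m /\ N - m = k).
  by exists (N - n), n.
exists m; split=> // m' Am'; have := H (N - m'); have := ub _ Am; have := ub _ Am'.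
by move=> ? ? /(_ (ex_intro _ m' (conj Am' erefl))); lia.
Qed.

Definition unbounded (A : nat -> Prop) := forall n, exists x, n <= x /\ A x.

(** Together with [unbounded], a form of [expanding] which does not mention
    successive elements, and is therefore easier to express and to refute. *)
Definition gappy (A : nat -> Prop) :=
  forall N, exists x, N <= x /\ forall i, i < N -> ~ A (x + i).

Lemma infinite_unbounded (A : set nat) : infinite_set A <-> unbounded A.
Proof.
split=> [infA n|unbA /finite_seqP[s As]].
  apply: contrapT => H; apply: infA; apply: sub_finite_set (finite_II n) => x Ax /=.
  by rewrite ltnNge; apply/negP => nx; apply: H; exists x.
have [x [sx Ax]] := unbA (\max_(i <- s) i).+1.
move: Ax; rewrite As /= => xs.
by have := @leq_bigmax_seq _ s xpredT id x xs isT; lia.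
Qed.

(** A gap of length more than 2N contains an interval of length N that starts
    after N.  Conversely an interval that misses A and starts after the least
    element of A lies between two successive elements of A. *)
Lemma expandingP (A : set nat) : expanding A <-> unbounded A /\ gappy A.
Proof.
rewrite /expanding infinite_unbounded; split=> -[unbA gapA]; split=> //.
  move=> N; apply: contrapT => H; apply: gapA; exists (2 * N) => a b [Aa Ab ab abA].
  rewrite leqNgt; apply/negP => ltN; apply: H; exists (a + N.+1); split; first lia.
  by move=> i iN; apply: abA; lia.
move=> [B HB]; have [a0 [_ Aa0]] := unbA 0.
have [x [Bx xA]] := gapA (maxn B a0).+1.
have [|y ay|a [[Aa ax] amax]] := @ex_greatest (fun a => A a /\ a < x) x.
- by exists a0; split=> //; lia.
- by case: ay; lia.
have [|b [[xb Ab] bmin]] := @ex_least (fun b => x <= b /\ A b).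
  exact: unbA.
have xMb : x + (maxn B a0).+1 <= b.
  rewrite leqNgt; apply/negP => bx; apply: (xA (b - x)); first lia.
  by rewrite subnKC.
have := HB a b; case/(_ _)/Wrap; last by lia.
split=> // [|c /andP[ac cb] Ac]; first lia.
case: (ltnP c x) => cx; first by have := amax c (conj Ac cx); lia.
by have := bmin c (conj cx Ac); lia.
Qed.

Lemma not_expanding (A : set nat) : ~ expanding A -> unbounded A ->
  exists B, forall x, B <= x -> exists i, i < B /\ A (x + i).
Proof.
rewrite expandingP => nE uA; apply: contrapT => H; apply: nE; split=> // N.
apply: contrapT => HN; apply: H; exists N => x Nx; apply: contrapT => Hx.
by apply: HN; exists x; split=> // i iN Ai; apply: Hx; exists i.
Qed.

(** The closure properties are selected by matching on the syntax of the goal: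
    up to unification several of them would apply, and search would diverge. *)
Ltac expressible_step :=
  lazymatch goal with
  | |- forall k, expressible_fun _ (fun r => scons _ _ k) =>
      apply: expressible_scons
  | |- forall k, expressible_fun _ (fun r => vapp _ _ k) =>
      apply: expressible_vapp
  | |- forall k, expressible_fun _ _ => move=> ?
  | |- expressible_fun _ (fun r => r _) => apply: expressible_var
  | |- expressible_fun _ (fun r => addn _ _) => apply: expressible_add
  | |- expressible_fun _ (fun r => bigop _ _ _) => apply: expressible_sum
  | |- expressible_fun _ (fun r => _) => apply: expressible_const
  | |- expressible (fun S r => _ /\ _) => apply: expressible_and
  | |- expressible (fun S r => _ <-> _) => apply: expressible_iff
  | |- expressible (fun S r => _ \/ _) => apply: expressible_or
  | |- expressible (fun S r => ~ _) => apply: expressible_not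
  | |- expressible (fun S r => exists a : nat, _) => apply: expressible_ex
  | |- expressible (fun S r => forall a : nat, _) => apply: expressible_all
  | |- expressible (fun S r => exists a : 'I__ -> nat, _) => apply: expressible_vex
  | |- expressible (fun S r => forall a : 'I__ -> nat, _) => apply: expressible_vall
  | |- expressible (fun S r => exists a : 'I__, _) => apply: expressible_fin_ex => ?
  | |- expressible (fun S r => forall a : 'I__, _) => apply: expressible_fin_all => ?
  | |- expressible (fun S r => _ -> _) => apply: expressible_imp
  | |- expressible (fun S r => _ = _ :> nat) => apply: expressible_eq
  | |- expressible (fun S r => is_true (leq (_.+1) _)) => apply: expressible_lt
  | |- expressible (fun S r => is_true (leq _ _)) => apply: expressible_le
  | H : expressible ?A |- expressible (fun S r => ?A S _) =>
      apply: (expressible_app H)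
  end; cbv beta.

Ltac solve_expressible := repeat expressible_step.

Section Forced.
Variable V : vocabulary.
Implicit Types P Q A : structure V -> env -> Prop.

(** Variable 0 is the element, the other variables are parameters. *)
Definition unary A S r : set nat := fun x => A S (x .: r).

Lemma expressible_expanding A : expressible A ->
  expressible (fun S r => expanding (unary A S r)).
Proof.
move=> dA; apply: (@expressible_ext _ (fun S r => unbounded (unary A S r) /\
  gappy (unary A S r))).
  by move=> S r; rewrite expandingP.
rewrite /unbounded /gappy /unary; solve_expressible.
Qed.

(** The formula that defines [A] is the same for all structures, but it may use
    the parameters of [P]. *)
Definition forced P : Prop := exists A, expressible A /\
  forall S r, ~ P S r -> expanding (unary A S r).

Lemma forced_imp P Q : (forall S r, P S r -> Q S r) -> forced P -> forced Q.
Proof.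
move=> PQ [A [dA AP]]; exists A; split=> // S r nQ.
by apply: AP => /PQ.
Qed.

Lemma forced_triv P : (forall S r, P S r) -> forced P.
Proof.
by move=> HP; exists (fun _ _ => True); split=> [|S r /(_ (HP S r))//];
  exact: expressible_true.
Qed.

Lemma forced_not_expanding A : expressible A ->
  forced (fun S r => ~ expanding (unary A S r)).
Proof. by move=> dA; exists A; split=> // S r /contrapT. Qed.

(** The new set is the first one if that is expanding, and the second one
    otherwise; this case distinction is itself expressible. *)
Lemma forced_and P Q : forced P -> forced Q -> forced (fun S r => P S r /\ Q S r).
Proof.
move=> [A [dA AP]] [B [dB BQ]].
pose E S r := expanding (unary A S r).
have dE : expressible E := expressible_expanding dA.
exists (fun S r => (E S (fun k => r k.+1) /\ A S r) \/
  (~ E S (fun k => r k.+1) /\ B S r)); split; first by solve_expressible.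
move=> S r nPQ; case: (pselect (E S r)) => HE.
  rewrite (_ : unary _ _ _ = unary A S r) //.
  by apply: funext => x; apply: propext; rewrite /unary; split=> [[] []//|]; left.
rewrite (_ : unary _ _ _ = unary B S r); last first.
  by apply: funext => x; apply: propext; rewrite /unary; split=> [[] []//|]; right.
apply: BQ => HQ; apply: HE; apply: AP => HP; exact: nPQ.
Qed.

(** The quantified parameter is replaced by the least one for which the set is
    expanding. *)
Lemma forced_all P : forced P -> forced (fun S r => forall c, P S (c .: r)).
Proof.
move=> [A [dA AP]]; pose E S r := expanding (unary A S r).
have dE : expressible E := expressible_expanding dA.
exists (fun S r => exists c, (E S (c .: (fun k => r k.+1)) /\
  forall c', c' < c -> ~ E S (c' .: (fun k => r k.+1))) /\
  A S (r 0 .: (c .: (fun k => r k.+1)))); split; first by solve_expressible.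
move=> S r nP; have [|c [Ec cmin]] := @ex_least (fun c => E S (c .: r)).
  apply: contrapT => H; apply: nP => c; apply: contrapT => nPc.
  by apply: H; exists c; exact: AP.
rewrite (_ : unary _ _ _ = unary A S (c .: r)) //.
apply: funext => x; apply: propext; rewrite /unary /=; split; last first.
  move=> Ax; exists c; split=> //; split=> // c' c'c /cmin; lia.
move=> [c' [[Ec' c'min] Ax]]; have := cmin _ Ec'.
rewrite leq_eqVlt => /predU1P[-> //|cc'].
by case: (c'min _ cc').
Qed.

Lemma forced_fin_all (I : finType) (P : I -> structure V -> env -> Prop) :
  (forall i, forced (P i)) -> forced (fun S r => forall i, P i S r).
Proof.
move=> fP.
have H (s : seq I) : forced (fun S r => forall i, i \in s -> P i S r).
  elim: s => [|i s IH]; first exact: forced_triv.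
  apply: forced_imp (forced_and (fP i) IH) => S r [K1 K2] j.
  by rewrite inE => /orP[/eqP->|/K2].
by apply: forced_imp (H (enum I)) => S r K i; apply: K; rewrite mem_enum.
Qed.

End Forced.

Definition ultimate_period (p : nat) (A : nat -> Prop) :=
  exists t, forall x, t <= x -> (A x <-> A (x + p)).

Lemma ultimate_period_mul k p A : ultimate_period p A -> ultimate_period (k * p) A.
Proof.
move=> [t H]; exists t => x tx; elim: k => [|k IH]; first by rewrite addn0.
by rewrite IH mulSn [p + _]addnC addnA; apply: H; lia.
Qed.

(** By Bezout: beyond both thresholds, go up from x by a multiple of p and down
    to x + gcd p q by a multiple of q. *)
Lemma ultimate_period_gcd p q A : 0 < p ->
  ultimate_period p A -> ultimate_period q A -> ultimate_period (gcdn p q) A.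
Proof.
move=> p0 /[dup] hp [t Hp] /[dup] hq [u Hq]; case: (egcdnP q p0) => k l e _.
have [t1 H1] := ultimate_period_mul k hp; have [t2 H2] := ultimate_period_mul l hq.
exists (maxn t1 t2) => x tx.
have x1 : t1 <= x by rewrite (leq_trans (leq_maxl _ _) tx).
have x2 : t2 <= x + gcdn p q.
  by rewrite (leq_trans (leq_trans (leq_maxr _ _) tx)) // leq_addr.
by have := H1 _ x1; have := H2 _ x2; rewrite e addnAC addnA => -> ->.
Qed.

(** What is used of sets of periods to combine them into a common period; unlike
    being the set of periods of one set, it is preserved by intersections. *)
Definition period_like (E : nat -> Prop) :=
  (forall k p, 0 < k -> E p -> E (k * p)) /\
  (forall p q, 0 < p -> 0 < q -> E p -> E q -> E (gcdn p q)).

Lemma period_like_ultimate_period A : period_like (fun p => ultimate_period p A).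
Proof.
by split=> [k p _|p q p0 q0]; [exact: ultimate_period_mul|exact: ultimate_period_gcd].
Qed.

Lemma period_like_all (T : Type) (E : T -> nat -> Prop) :
  (forall t, period_like (E t)) -> period_like (fun p => forall t, E t p).
Proof.
move=> H; split=> [k p k0 Ep t|p q p0 q0 Ep Eq t]; first exact: (H t).1.
by apply: (H t).2.
Qed.

(** The least common period of the first n conditions divides the one of the
    first m conditions if n <= m, by [period_like] and minimality.  So each
    strict increase at least doubles it, and if it is unbounded its values form
    an expanding set; if it is bounded its maximum is a common period. *)
Lemma common_period (E : nat -> nat -> Prop) :
  (forall c, period_like (E c)) ->
  (forall c, exists p, 0 < p /\ E c p) ->
  let L n p := [/\ 0 < p, forall c, c <= n -> E c p &
      forall q, 0 < q -> (forall c, c <= n -> E c q) -> p <= q] in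
  ~ expanding [set p | exists n, L n p] ->
  exists p, 0 < p /\ forall c, E c p.
Proof.
move=> HE ex L nexp.
have exL n : exists p, L n p.
  suff [p [p0 Ep]] : exists p, 0 < p /\ forall c, c <= n -> E c p.
    have [|q [[q0 Eq] qmin]] := @ex_least (fun p => 0 < p /\ forall c, c <= n -> E c p).
      by exists p.
    by exists q; split=> // q' q'0 Eq'; apply: qmin.
  elim: n => [|n [p [p0 Ep]]].
    by have [p [p0 Ep]] := ex 0; exists p; split=> // c; rewrite leqn0 => /eqP->.
  have [q [q0 Eq]] := ex n.+1; exists (p * q); split=> [|c]; first by rewrite muln_gt0 p0.
  rewrite leq_eqVlt => /predU1P[->|]; first exact: (HE _).1.
  by rewrite ltnS mulnC => /Ep; exact: (HE _).1.
have Ldvd n m p q : L n p -> L m q -> n <= m -> p %| q.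
  move=> [p0 Ep pmin] [q0 Eq _] nm; apply/gcdn_idPl/anti_leq.
  rewrite dvdn_leq ?dvdn_gcdl //=; apply: pmin; first by rewrite gcdn_gt0 p0.
  by move=> c cn; apply: (HE c).2 => //; [exact: Ep|apply: Eq; lia].
apply: contrapT => npE; apply: nexp; apply/expandingP.
have grow n p : L n p -> exists q, p < q /\ exists m, L m q.
  move=> Lnp; apply: contrapT => H; apply: npE; exists p.
  case: (Lnp) => p0 Ep _; split=> // c.
  have [q Lq] := exL (maxn n c).
  have pq := Ldvd _ _ _ _ Lnp Lq (leq_maxl _ _).
  suff <- : q = p by case: Lq => _ + _; apply; lia.
  apply: anti_leq; rewrite [X in _ && X]dvdn_leq ?andbT //; last by case: Lq.
  by rewrite leqNgt; apply/negP => lt; apply: H; exists q; split=> //; eexists; exact: Lq.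
have uL : unbounded (fun p => exists n, L n p).
  elim=> [|N [p [Np [n Lnp]]]]; first by have [p Lp] := exL 0; exists p; split=> //; exists 0.
  by have [q [pq Lq]] := grow _ _ Lnp; exists q; split=> //; lia.
split=> // N; have [p [Np [n Lnp]]] := uL N.+1.
exists p.+1; split=> [|i iN [m Lm]]; first lia.
have [nm|/ltnW mn] := leqP n m.
  have /dvdnP[k ek] := Ldvd _ _ _ _ Lnp Lm nm; case: k ek => [|[|k]]; rewrite ?mulSn; lia.
have := Ldvd _ _ _ _ Lm Lnp mn; case: Lnp => p0 _ _ /(dvdn_leq p0); lia.
Qed.

Section Period.
Variable V : vocabulary.
Implicit Types P Q A E : structure V -> env -> Prop.

Lemma forced_common_period E : expressible E ->
  (forall S r, period_like (fun p => E S (p .: r))) ->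
  forced (fun S r => exists p, 0 < p /\ E S (p .: r)) ->
  forced (fun S r => exists p, 0 < p /\ forall c, E S (p .: (c .: r))).
Proof.
move=> dE HE fE.
pose L S r := exists n, ((0 < r 0 /\ forall c, c <= n -> E S (r 0 .: (c .: (fun k => r k.+1))))
  /\ forall q, 0 < q -> (forall c, c <= n -> E S (q .: (c .: (fun k => r k.+1)))) -> r 0 <= q).
have dL : expressible L by rewrite /L; solve_expressible.
apply: forced_imp (forced_and (forced_all fE) (forced_not_expanding dL)) => S r [H1 H2].
apply: (@common_period (fun c p => E S (p .: (c .: r)))) => // HX.
apply: H2; move: HX; rewrite (_ : mkset _ = unary L S r) //.
apply: funext => p; apply: propext; rewrite /unary /L /=.
by split=> -[n]; [case=> ? ? ?|case=> -[? ?] ?]; exists n.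
Qed.

End Period.

Lemma uniform_bound (I : finType) (Q : I -> nat -> Prop) :
  (forall i m n, m <= n -> Q i m -> Q i n) ->
  (forall i, exists n, Q i n) -> exists n, forall i, Q i n.
Proof.
move=> mono /choice[f fP]; exists (\max_i f i) => i.
exact: mono (leq_bigmax i) (fP i).
Qed.

Section LeastRecurrentWord.
Variable A : nat -> Prop.

Definition disagree p : set nat := fun x => ~ (A x <-> A (x + p)).

Definition same n x y := forall i, i < n -> (A (x + i) <-> A (y + i)).

Definition recurrent n x := forall t, exists y, t <= y /\ same n x y.

Definition lex_le n x y := forall i, i < n -> same i x y -> A (x + i) -> A (y + i).

Definition least_recurrent n x := recurrent n x /\
  forall y, recurrent n y -> lex_le n x y.

(** First occurrences, after n, of the lexicographically least recurrent word of
    length n, for all n. *)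
Definition first_least : set nat := fun x => exists n, (n <= x /\
  least_recurrent n x) /\ forall y, n <= y -> least_recurrent n y -> x <= y.

Lemma same_sym n x y : same n x y -> same n y x.
Proof. by move=> H i /H ->. Qed.

Lemma same_trans n x y z : same n x y -> same n y z -> same n x z.
Proof. by move=> H K i Hi; rewrite H // K. Qed.

Lemma sameW m n x y : m <= n -> same n x y -> same m x y.
Proof. by move=> mn H i im; apply: H; lia. Qed.

Lemma lex_le_anti n x y : lex_le n x y -> lex_le n y x -> same n x y.
Proof.
move=> H K; elim/ltn_ind=> i IH lin.
have S : same i x y by move=> j ji; apply: IH => //; lia.
by split; [apply: H|apply: K => //; apply: same_sym].
Qed.

Lemma same_recurrent n x y : same n x y -> recurrent n x -> recurrent n y.
Proof.
by move=> xy H t; have [z [tz xz]] := H t; exists z; split=> //;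
  apply: same_trans xz; apply: same_sym.
Qed.

Lemma recurrentW n x : recurrent n.+1 x -> recurrent n x.
Proof. by move=> H t; have [y [ty xy]] := H t; exists y; split=> //; apply: sameW xy. Qed.

(** One of the two extensions of a recurrent word by a letter is recurrent:
    otherwise, beyond the last occurrences of both extensions, there is still an
    occurrence of the word. *)
Lemma recurrentS n x : recurrent n x -> exists y, same n x y /\ recurrent n.+1 y.
Proof.
move=> H; apply: contrapT => nE.
have stop y : same n x y -> exists t, forall z, t <= z -> ~ same n.+1 y z.
  move=> xy; apply: contrapT => K; apply: nE; exists y; split=> // t.
  by apply: contrapT => K'; apply: K; exists t => z tz S; apply: K'; exists z.
have [y0 [_ S0]] := H 0; have [t0 T0] := stop _ S0.
have [y1 [ty1 S1]] := H t0; have [t1 T1] := stop _ S1.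
have [y2 [ty2 S2]] := H (maxn t0 t1).
(* the letters after the words at y0, y1, y2 would be pairwise different *)
have d0 : ~ (A (y0 + n) <-> A (y1 + n)).
  move=> e; apply: (T0 y1) => // i; rewrite ltnS leq_eqVlt => /predU1P[-> //|lin].
  by apply: same_trans S1 i lin; apply: same_sym.
have d1 : ~ (A (y0 + n) <-> A (y2 + n)).
  move=> e; apply: (T0 y2) => [|i]; first lia.
  rewrite ltnS leq_eqVlt => /predU1P[-> //|lin].
  by apply: same_trans S2 i lin; apply: same_sym.
apply: (T1 y2) => [|i]; first lia.
rewrite ltnS leq_eqVlt => /predU1P[->|lin]; last first.
  by apply: same_trans S2 i lin; apply: same_sym.
by case: (pselect (A (y0 + n))) (pselect (A (y1 + n))) (pselect (A (y2 + n)))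
  => ? [] ? [] ?; tauto.
Qed.

Lemma least_recurrentW n x : least_recurrent n.+1 x -> least_recurrent n x.
Proof.
move=> [Rx xmin]; split=> [|y Ry]; first exact: recurrentW.
have [z [yz Rz]] := recurrentS Ry => i lin xy.
have -> : A (y + i) <-> A (z + i) by exact: yz.
apply: xmin => //; first lia.
by apply: same_trans xy _; apply: sameW yz; lia.
Qed.

Lemma least_recurrent_le m n x : m <= n -> least_recurrent n x -> least_recurrent m x.
Proof.
move=> mn; rewrite -(subnKC mn); elim: (n - m) => [|k IH]; first by rewrite addn0.
by rewrite addnS => /least_recurrentW.
Qed.

Lemma same_least_recurrent n x y : same n x y -> least_recurrent n x ->
  least_recurrent n y.
Proof.
move=> xy [Rx xmin]; split=> [|z /xmin H i lin yz]; first exact: same_recurrent Rx.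
by rewrite -xy //; apply: H => //; apply: same_trans yz; apply: sameW xy; lia.
Qed.

(** By induction on the length: extend the least recurrent word by the letter
    false if that keeps it recurrent. *)
Lemma ex_least_recurrent n : exists x, least_recurrent n x.
Proof.
elim: n => [|n [x [Rx xmin]]].
  by exists 0; split=> [t|y _ i //]; exists t; split=> // i.
have lexS y z : same n x y -> recurrent n.+1 z ->
    (same n y z -> A (y + n) -> A (z + n)) -> lex_le n.+1 y z.
  move=> xy Rz yz i; rewrite ltnS leq_eqVlt => /predU1P[-> //|lin] S.
  have := xmin _ (recurrentW Rz) i lin; rewrite (xy _ lin); apply.
  by apply: same_trans S; apply: sameW xy; lia.
case: (pselect (exists y, [/\ same n x y, recurrent n.+1 y & ~ A (y + n)])).
  by move=> [y [xy Ry nA]]; exists y; split=> // z Rz; apply: lexS.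
move=> H; have [y [xy Ry]] := recurrentS Rx.
exists y; split=> // z Rz; apply: lexS => // yz _; apply: contrapT => nAz.
by apply: H; exists z; split=> //; apply: same_trans yz.
Qed.

Lemma ex_first_least n : exists x, (n <= x /\ least_recurrent n x) /\
  forall y, n <= y -> least_recurrent n y -> x <= y.
Proof.
have [x0 Lx0] := ex_least_recurrent n; have [x [nx x0x]] := Lx0.1 n.
have Lx := same_least_recurrent x0x Lx0.
have [|y [[ny Ly] ymin]] := @ex_least (fun y => n <= y /\ least_recurrent n y).
  by exists x.
by exists y; split=> // z nz Lz; apply: ymin.
Qed.

(** If A has no period and no [disagree p] is expanding, then each of these sets
    meets all far enough intervals of some bounded length; let M be such a length
    for all p up to the bound B on the gaps of [first_least].  For some large n the
    first occurrences x < y of the least recurrent words of lengths n and n + 1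
    satisfy y - x <= B, and A agrees with its translate by y - x on the n
    entries after x, so that [disagree (y - x)] misses an interval of length M. *)
Lemma ultimate_period_of_not_expanding : (forall p, ~ expanding (disagree p)) ->
  ~ expanding first_least -> exists p, 0 < p /\ ultimate_period p A.
Proof.
move=> nD nE; apply: contrapT => nP.
have uD p : 0 < p -> unbounded (disagree p).
  move=> p0; apply: contrapT => H; apply: nP; exists p; split=> //.
  apply: contrapT => K; apply: H => n; apply: contrapT => K'; apply: K.
  by exists n => x nx; apply: contrapT => dx; apply: K'; exists x.
have uE : unbounded first_least.
  move=> n; have [x [[nx Lx] xmin]] := ex_first_least n.
  by exists x; split=> //; exists n.
have [B HB] := not_expanding nE uE.
pose F n x := (n <= x /\ least_recurrent n x) /\
  forall y, n <= y -> least_recurrent n y -> x <= y.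
have Fmono m n x y : m <= n -> F m x -> F n y -> x <= y.
  move=> mn [_ xmin] [[ny Ly] _]; apply: xmin; first lia.
  exact: least_recurrent_le Ly.
have [||M HM] := @uniform_bound 'I_B.+1 (fun p M => 0 < p ->
    forall x, M <= x -> exists i, i < M /\ disagree p (x + i)).
- move=> p m n mn H p0 x nx; have [|i [im Di]] := H p0 x; first lia.
  by exists i; split=> //; lia.
- move=> p; case: (posnP p) => [-> |p0]; first by exists 0.
  by have [m Hm] := not_expanding (nD p) (uD _ p0); exists m.
pose N := maxn M B.
have [n [x [y [Nn Fx Fy xy]]]] :
    exists n x y, [/\ N <= n, F n x, F n.+1 y & x < y].
  apply: contrapT => H.
  have step n x : N <= n -> F n x -> F n.+1 x.
    move=> Nn Fx; have [y Fy] := ex_first_least n.+1.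
    suff -> : x = y by [].
    apply/eqP; rewrite eqn_leq (Fmono _ _ _ _ (leqnSn n) Fx Fy) leqNgt.
    by apply/negP => xy; apply: H; exists n, x, y.
  have [x Fx] := ex_first_least N.
  have {step} Fk k : F (N + k) x.
    by elim: k => [|k IH]; rewrite ?addn0 // addnS; apply: step => //; apply: leq_addr.
  by have [[]] := Fk x.+1; lia.
have [[nx Lx] _] := Fx; have [[ny Ly] _] := Fy.
have yB : y - x < B.+1.
  have [|i [iB [m [[mx Lm] zmin]]]] := HB x.+1; first lia.
  have [mn|nm] := leqP m n.
    by have := Fmono _ _ _ _ mn (conj (conj mx Lm) zmin) Fx; lia.
  by have := Fmono _ _ _ _ nm Fy (conj (conj mx Lm) zmin); lia.
have xyn : same n x y.
  have Ly' := least_recurrentW Ly.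
  by apply: lex_le_anti; [apply: Lx.2 Ly'.1|apply: Ly'.2 Lx.1].
have [||i [iM]] := HM (Ordinal yB) _ x; rewrite /= ?subn_gt0 //; first lia.
apply; rewrite addnAC subnKC; last by lia.
by apply: xyn; lia.
Qed.

End LeastRecurrentWord.

Section UltimatelyPeriodic.
Variable V : vocabulary.
Implicit Types P Q A E : structure V -> env -> Prop.

Lemma forced_ultimate_period A : expressible A ->
  forced (fun S r => exists p, 0 < p /\ ultimate_period p (unary A S r)).
Proof.
move=> dA.
pose D S r := ~ (A S (r 0 .: (fun k => r k.+2)) <-> A S (r 0 + r 1 .: (fun k => r k.+2))).
have dD : expressible D by rewrite /D; solve_expressible.
pose F S r := first_least (unary A S (fun k => r k.+1)) (r 0).
have dF : expressible F.
  rewrite /F /first_least /least_recurrent /recurrent /lex_le /same /unary; solve_expressible.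
apply: forced_imp (forced_and (forced_all (forced_not_expanding dD))
  (forced_not_expanding dF)) => S r [H1 H2].
by apply: ultimate_period_of_not_expanding => // p; apply: H1.
Qed.

Lemma expressible_ultimate_period A : expressible A ->
  expressible (fun S r => ultimate_period (r 0) (unary A S (fun k => r k.+1))).
Proof. by move=> dA; rewrite /ultimate_period /unary; solve_expressible. Qed.

(** Universal quantification over the [n] variables following variable 0. *)
Fixpoint all_params (E : structure V -> env -> Prop) n S r : Prop :=
  if n is n'.+1 then
    forall c, all_params E n' S (r 0 .: (c .: (fun k => r k.+1)))
  else E S r.

(** Quantifies the parameters one at a time by [forced_common_period], until
    all those in the formula of [A] have been treated. *)
Lemma forced_uniform_ultimate_period A : expressible A ->
  forced (fun S _ => exists p, 0 < p /\ forall r, ultimate_period p (unary A S r)).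
Proof.
move=> dA.
pose E := all_params (fun S r => ultimate_period (r 0) (unary A S (fun k => r k.+1))).
have EP n S p r : E n S (p .: r) -> forall s : env,
    ultimate_period p (unary A S (fun k => if k < n then s k else r (k - n))).
  elim: n r => [|n IH] r /=.
    by move=> H s; under [X in unary _ _ X]eq_fun do rewrite subn0.
  move=> H s; have := IH _ (H (s n)) s.
  congr (ultimate_period _ (unary _ _ _)); apply: funext => k.
  case: (ltngtP k n) => [kn|kn|->] /=.
  - by rewrite ltnS (ltnW kn).
  - by rewrite ltnS leqNgt kn /= -[k - n]prednK ?subn_gt0 //= subnS.
  - by rewrite subnn ltnSn.
have [N [phi phiP]] := dA.
suff H n : [/\ expressible (E n), forall S r, period_like (fun p => E n S (p .: r))
    & forced (fun S r => exists p, 0 < p /\ E n S (p .: r))].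
  have [_ _ fE] := H N.
  apply: forced_imp fE => S r [p [p0 Ep]]; exists p; split=> // s.
  have [t Ht] := EP _ _ _ _ Ep s; exists t => x tx; have := Ht x tx.
  have E1 y : unary A S (fun k => if k < N then s k else r (k - N)) y <-> unary A S s y.
    rewrite /unary !phiP; set u := prefix_tuple _ _; set u' := prefix_tuple _ _.
    suff -> : u = u' by [].
    apply: eq_from_tnth => i; rewrite !tnth_mktuple.
    by case: i => -[|i] //= iN; rewrite ltnW.
  by rewrite !E1.
elim: n => [|n [dE lE fE]].
  split=> [|S r|]; first exact: expressible_ultimate_period.
    exact: (period_like_ultimate_period (unary A S r)).
  exact: forced_ultimate_period.
split; last exact: forced_common_period.
  change (expressible (fun S r => forall c, E n S (r 0 .: (c .: (fun k => r k.+1))))).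
  by solve_expressible.
move=> S r; exact: (@period_like_all nat (fun c p => E n S (p .: (c .: r)))
  (fun c => lE S (c .: r))).
Qed.

End UltimatelyPeriodic.

(** * Quantifier-free Presburger sets and local periodicity *)

Section QuantifierFree.
Import Order.TTheory GRing.Theory Num.Theory.
Local Open Scope ring_scope.

Inductive aff (I : Type) : ((I -> int) -> int) -> Prop :=
| aff_var i : aff (fun x => x i)
| aff_const c : aff (fun=> c)
| aff_add l m : aff l -> aff m -> aff (fun x => l x + m x)
| aff_scale a l : aff l -> aff (fun x => a * l x).

(** Closure under exclusive or instead of disjunction: it is addition modulo 2,
    for which sums along a line are additive. *)
Inductive qf (I : Type) : ((I -> int) -> bool) -> Prop :=
| qf_ge l : aff l -> qf (fun x => 0 <= l x)
| qf_dvd (q : nat) l : (0 < q)%N -> aff l -> qf (fun x => (q %| l x)%Z)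
| qf_const b : qf (fun=> b)
| qf_xor f g : qf f -> qf g -> qf (fun x => f x (+) g x)
| qf_and f g : qf f -> qf g -> qf (fun x => f x && g x).

Lemma qf_ext I (f g : (I -> int) -> bool) : f =1 g -> qf f -> qf g.
Proof. by move=> /funext ->. Qed.

Lemma qf_neg I (f : (I -> int) -> bool) : qf f -> qf (fun x => ~~ f x).
Proof. by move=> qff; apply: qf_ext (qf_xor qff (qf_const _ true)) => x; rewrite addbT. Qed.

Lemma aff_sub I (l m : (I -> int) -> int) :
  aff l -> aff m -> aff (fun x => l x - m x).
Proof.
move=> al am; rewrite (_ : (fun _ => _) = fun x => l x + (-1) * m x).
  by apply: aff_add => //; apply: aff_scale.
by apply: funext => x; rewrite mulN1r.
Qed.

Lemma qf_le I (l m : (I -> int) -> int) :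
  aff l -> aff m -> qf (fun x => l x <= m x).
Proof.
by move=> al am; apply: qf_ext (qf_ge (aff_sub am al)) => x; rewrite subr_ge0.
Qed.

Lemma qf_eq I (l m : (I -> int) -> int) :
  aff l -> aff m -> qf (fun x => l x == m x).
Proof.
move=> al am; apply: qf_ext (qf_and (qf_le al am) (qf_le am al)) => x.
by rewrite eq_le.
Qed.

Lemma qf_big I n (f : 'I_n -> (I -> int) -> bool) : (forall r, qf (f r)) ->
  qf (fun x => \big[addb/false]_(r < n) f r x).
Proof.
move=> qff; have H (s : seq 'I_n) : qf (fun x => \big[addb/false]_(r <- s) f r x).
  elim: s => [|r s IH].
    by apply: qf_ext (qf_const _ false) => x; rewrite big_nil.
  by apply: qf_ext (qf_xor (qff r) IH) => x; rewrite big_cons.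
exact: H.
Qed.

Lemma aff_comp I J (s : (J -> int) -> I -> int) l :
  (forall i, aff (fun y => s y i)) -> aff l -> aff (fun y => l (s y)).
Proof.
by move=> as_; elim=> [i|c|l1 l2 _ IH1 _ IH2|a l1 _ IH];
  [exact: as_|exact: aff_const|exact: aff_add|exact: aff_scale].
Qed.

Lemma qf_comp I J (s : (J -> int) -> I -> int) f :
  (forall i, aff (fun y => s y i)) -> qf f -> qf (fun y => f (s y)).
Proof.
move=> as_; elim=> [l al|q l q0 al|b|f1 f2 _ IH1 _ IH2|f1 f2 _ IH1 _ IH2].
- by apply: (qf_ge (l := fun y => l (s y))); apply: aff_comp.
- by apply: (qf_dvd (l := fun y => l (s y))) => //; apply: aff_comp.
- exact: qf_const.
- exact: qf_xor.
- exact: qf_and.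
Qed.

Definition translate I (w : I -> int) (x : I -> int) : I -> int := fun i => x i - w i.

Lemma qf_translate I (w : I -> int) f : qf f -> qf (fun y => f (translate w y)).
Proof. by apply: qf_comp => i; apply: aff_sub; [exact: aff_var|exact: aff_const]. Qed.

Section Summation.
Variable I : Type.
Implicit Types (f g A : (I -> int) -> bool) (l : (I -> int) -> int).
Implicit Types (G H U : (I -> int) -> nat -> bool) (w : I -> nat).

(** The conditions on [j] occurring when a quantifier-free set is followed along
    the half-line y, y - w, y - 2w and so on: no bound, or an upper bound
    depending linearly on [y]. *)
Inductive upper : ((I -> int) -> nat -> bool) -> Prop :=
| upper_top : upper (fun _ _ => true)
| upper_le (b : nat) l : (0 < b)%N -> aff l -> upper (fun y j => (b * j)%:Z <= l y).

(** Modulo 2, any quantifier-free set is along such a half-line a sum of terms,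
    each with one upper bound and one periodic condition on [j]; lower bounds
    are complements of upper bounds, and of two upper bounds the smaller one is
    kept, at the price of a condition on [y] ([upper_min]). *)
Inductive step : ((I -> int) -> nat -> bool) -> Prop :=
| step_term A (P : nat -> bool) q U : qf A -> (0 < q)%N ->
    (forall j, P (j + q)%N = P j) -> upper U ->
    step (fun y j => [&& A y, P j & U y j])
| step_xor G H : step G -> step H -> step (fun y j => G y j (+) H y j).

Lemma step_ext G H : (forall y j, G y j = H y j) -> step G -> step H.
Proof.
by move=> GH; have -> : G = H by apply: funext => y; apply: funext => j.
Qed.

Lemma le_cross (b c j : nat) (L M : int) : (0 < b)%N ->
  c%:Z * L <= b%:Z * M -> (b * j)%:Z <= L -> (c * j)%:Z <= M.
Proof.
move=> b0 LM bL; have : c%:Z * (b * j)%:Z <= c%:Z * L by rewrite ler_wpM2l.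
by move=> /le_trans /(_ LM); rewrite !PoszM mulrCA ler_pM2l ?ltz_nat.
Qed.

Lemma upper_min U U' : upper U -> upper U' ->
  exists A, qf A /\ forall y j, U y j && U' y j = if A y then U y j else U' y j.
Proof.
case=> [|b l b0 al] [|c m c0 am].
- by exists (fun=> true); split=> //; exact: qf_const.
- by exists (fun=> false); split=> //; exact: qf_const.
- by exists (fun=> true); split=> [|y j]; [exact: qf_const|rewrite andbT].
- exists (fun y => c%:Z * l y <= b%:Z * m y); split.
    by apply: qf_le; apply: aff_scale.
  move=> y j; case: ifP => H.
    by apply/andP/idP => [[]//|K]; split=> //; apply: le_cross K.
  apply/andP/idP => [[]//|K]; split=> //; apply: le_cross K => //.
  by rewrite ltW // ltNge H.
Qed.

Lemma step_and G H : step G -> step H -> step (fun y j => G y j && H y j).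
Proof.
move=> sG; elim: sG H => {G} [A P q U qA q0 PP uU|G1 G2 _ IH1 _ IH2] H sH; last first.
  by apply: step_ext (step_xor (IH1 _ sH) (IH2 _ sH)) => y j; rewrite andb_addl.
elim: sH => {H} [A' P' q' U' qA' q'0 PP' uU'|G1 G2 _ IH1 _ IH2]; last first.
  by apply: step_ext (step_xor IH1 IH2) => y j; rewrite andb_addr.
have [B [qB HB]] := upper_min uU uU'.
have per k m (R : nat -> bool) : (forall j, R (j + m)%N = R j) ->
    forall j, R (j + k * m)%N = R j.
  by move=> HR j; elim: k => [|k IH]; rewrite ?addn0 // mulSn addnCA addnC HR.
have PP2 j : P (j + q * q')%N && P' (j + q * q')%N = P j && P' j.
  by rewrite (per q q' P') // mulnC (per q' q P).
have qq0 : (0 < q * q')%N by rewrite muln_gt0 q0.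
apply: step_ext (step_xor
  (@step_term (fun y => [&& A y, A' y & B y]) _ _ _ _ qq0 PP2 uU)
  (@step_term (fun y => [&& A y, A' y & ~~ B y]) _ _ _ _ qq0 PP2 uU')).
- move=> y j /=; rewrite [RHS](_ : _ = [&& A y && A' y, P j && P' j & U y j && U' y j]).
    by rewrite HB; case: (A y); case: (A' y); case: (B y) => //=; rewrite ?addbF.
  by case: (A y); case: (A' y); case: (P j); case: (P' j); rewrite ?andbF.
- by do !apply: qf_and => //.
- by do !apply: qf_and => //; apply: qf_neg.
Qed.

Lemma step_big n (G : 'I_n -> (I -> int) -> nat -> bool) : (forall r, step (G r)) ->
  step (fun y j => \big[addb/false]_(r < n) G r y j).
Proof.
move=> sG; have H (s : seq 'I_n) : step (fun y j => \big[addb/false]_(r <- s) G r y j).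
  elim: s => [|r s IH].
    apply: step_ext (@step_term (fun=> false) (fun=> true) 1 _ (qf_const _ _) isT _ upper_top).
      by move=> y j; rewrite big_nil.
    by [].
  by apply: step_ext (step_xor (sG r) IH) => y j; rewrite big_cons.
exact: H.
Qed.

Definition move_back w (y : I -> int) (j : nat) : I -> int := fun i => y i - (j * w i)%:Z.

Lemma aff_move_back w l : aff l -> exists b : int, forall y j, l (move_back w y j) = l y - j%:Z * b.
Proof.
elim=> {l} [i|c|l1 l2 _ [b1 H1] _ [b2 H2]|a l _ [b H]].
- by exists (w i)%:Z => y j; rewrite /move_back PoszM.
- by exists 0 => y j; rewrite mulr0 subr0.
- by exists (b1 + b2) => y j; rewrite H1 H2; ring.
- by exists (a * b) => y j; rewrite H; ring.
Qed.

Lemma xor_single n k (F : 'I_n -> bool) (kn : (k < n)%N) :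
  \big[addb/false]_(r < n) ((r == k :> nat) && F r) = F (Ordinal kn).
Proof.
rewrite (bigD1 (Ordinal kn)) //= eqxx /= big1 ?addbF // => r.
by rewrite -val_eqE /= => /negbTE->.
Qed.

(** Induction on [f], with products handled by [step_and]. *)
Lemma step_move_back w f : qf f -> step (fun y j => f (move_back w y j)).
Proof.
elim=> {f} [l al|q l q0 al|b|f g _ IH1 _ IH2|f g _ IH1 _ IH2].
- have [b Hb] := aff_move_back w al.
  have T1 (A : (I -> int) -> bool) U : qf A -> upper U -> step (fun y j => A y && U y j).
    by move=> qA uU; apply: step_ext (@step_term A (fun=> true) 1 U qA isT _ uU).
  case: b Hb => [[|b]|b] Hb.
  + apply: step_ext (T1 _ _ (qf_ge al) upper_top) => y j.
    by rewrite Hb mulr0 subr0 andbT.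
  + apply: step_ext (T1 _ _ (qf_const _ true) (upper_le (ltn0Sn b) al)) => y j.
    by rewrite Hb subr_ge0 /= -PoszM mulnC.
  + have al' : aff (fun y => (-1) * l y + (-1)).
      by apply: aff_add; [apply: aff_scale|apply: aff_const].
    apply: step_ext (step_xor (T1 _ _ (qf_const _ true) upper_top)
      (T1 _ _ (qf_const _ true) (upper_le (ltn0Sn b) al'))) => y j /=.
    rewrite Hb NegzE -ltNge mulrN opprK PoszM [j%:Z * _]mulrC; lia.
- have [b Hb] := aff_move_back w al.
  pose G (r : 'I_q) := fun (y : I -> int) j =>
    [&& (q %| l y - r%:Z * b)%Z, (r == (j %% q)%N :> nat) & true].
  have sG r : step (G r).
    apply: (@step_term _ (fun j => r == (j %% q)%N :> nat) q _ _ q0 _ upper_top).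
      apply: (qf_dvd (l := fun y => l y - r%:Z * b)) => //.
      by apply: aff_sub => //; apply: aff_const.
    by move=> j; rewrite modnDr.
  apply: step_ext (step_big sG) => y j; rewrite /G.
  under eq_bigr => r _ do rewrite andbT andbC.
  rewrite (xor_single (k := j %% q) _ (ltn_pmod j q0)) /= Hb.
  rewrite -!eqz_mod_dvd [in RHS](divn_eq j q) PoszD PoszM mulrDl.
  by rewrite mulrAC modzMDl.
- by apply: step_ext (@step_term (fun=> b) (fun=> true) 1 _ (qf_const _ b) isT _ upper_top)
    => // y j; rewrite !andbT.
- exact: step_xor.
- exact: step_and.
Qed.

(** Stated with partial sums, so that no bound on the support in [j] has to be
    computed from [y]. *)
Definition summable G := exists s, qf s /\ forall y, exists M0, forall M, (M0 <= M)%N ->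
  \big[addb/false]_(j < M) G y j = s y.

Lemma summable_xor G H : summable G -> summable H -> summable (fun y j => G y j (+) H y j).
Proof.
move=> [s [qs Hs]] [t [qt Ht]]; exists (fun y => s y (+) t y); split; first exact: qf_xor.
move=> y; have [M HM] := Hs y; have [N HN] := Ht y; exists (maxn M N) => K.
by rewrite geq_max => /andP[MK NK]; rewrite big_split /= HM ?HN.
Qed.

Lemma summable_ext G H : (forall y j, G y j = H y j) -> summable G -> summable H.
Proof.
by move=> GH; have -> : G = H by apply: funext => y; apply: funext => j.
Qed.

(** Two consecutive periods contribute the same number, hence an even total. *)
Lemma parity_periodic (P : nat -> bool) q n t : (forall j, P (j + q)%N = P j) ->
  \big[addb/false]_(j < n + t * (2 * q)) P j = \big[addb/false]_(j < n) P j.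
Proof.
move=> HP; have split_at k n' : \big[addb/false]_(j < k + n') P j =
    \big[addb/false]_(j < k) P j (+) \big[addb/false]_(j < n') P (k + j)%N.
  by rewrite big_split_ord.
elim: t => [|t IH]; first by rewrite addn0.
rewrite -{}IH mulSn [(_ + t * _)%N]addnC addnA; set m := (n + _)%N.
rewrite mul2n -addnn addnA !split_at -[RHS]addbF -addbA; congr (_ (+) _).
rewrite [X in _ (+) X](eq_bigr (fun j : 'I_q => P (m + j)%N)) ?addbb // => j _.
by rewrite addnAC HP.
Qed.

(** The sum stops at the integral part of l y / b, so its parity depends only on
    the residue of l y modulo 2qb. *)
Lemma summable_term A (P : nat -> bool) q b l : qf A -> (0 < q)%N ->
  (forall j, P (j + q)%N = P j) -> (0 < b)%N -> aff l ->
  summable (fun y j => [&& A y, P j & (b * j)%:Z <= l y]).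
Proof.
move=> qA q0 HP b0 al; pose Q n := \big[addb/false]_(j < n) P j.
pose m := (2 * q * b)%N; have m0 : (0 < m)%N by rewrite !muln_gt0 q0.
exists (fun y => [&& A y, 0 <= l y & \big[addb/false]_(r < m)
  ((m %| l y - r%:Z)%Z && Q (r %/ b).+1)]); split.
  apply: qf_and => //; apply: qf_and; first exact: qf_ge.
  apply: qf_big => r; apply: qf_and; last exact: qf_const.
  apply: (qf_dvd (l := fun y => l y - r%:Z)) => //.
  by apply: aff_sub => //; exact: aff_const.
move=> y; case: (A y) => /=; last by exists 0%N => M _; rewrite big1.
case: (l y) => [L|L] /=; last first.
  by exists 0%N => M _; rewrite big1 // => j _; rewrite (_ : _ <= _ = false) ?andbF //; lia.
exists (L %/ b).+1 => M LM.
have -> : \big[addb/false]_(j < M) (P j && ((b * j)%:Z <= L%:Z)) = Q (L %/ b).+1.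
  rewrite /Q (big_ord_widen _ (fun j => P j) LM) [RHS]big_mkcond.
  apply: eq_bigr => j _; rewrite lez_nat mulnC ltnS leq_divRL //.
  by case: ifP; rewrite ?andbT ?andbF.
have Lm : (L %% m < m)%N by rewrite ltn_mod.
have -> : \big[addb/false]_(r < m) ((m %| L%:Z - r%:Z)%Z && Q (r %/ b).+1) =
    \big[addb/false]_(r < m) ((r == (L %% m)%N :> nat) && Q (r %/ b).+1).
  apply: eq_bigr => r _; rewrite -eqz_mod_dvd !modz_nat eqz_nat eq_sym.
  by rewrite [(r %% m)%N]modn_small.
rewrite xor_single /= {1}(divn_eq L m) /m mulnA divnMDl // -addnS addnC.
exact: parity_periodic.
Qed.

Lemma summable_step G l : step G -> aff l -> summable (fun y j => G y j && (j%:Z <= l y)).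
Proof.
move=> sG al; elim: sG => {G} [A P q U qA q0 HP uU|G H _ IH1 _ IH2]; last first.
  by apply: summable_ext (summable_xor IH1 IH2) => y j; rewrite andb_addl.
case: uU => [|b m b0 am].
  apply: summable_ext (summable_term qA q0 HP (ltn0Sn 0) al) => y j.
  by rewrite mul1n andbT andbA.
have [B [qB HB]] := upper_min (upper_le b0 am) (upper_le (ltn0Sn 0) al).
apply: summable_ext (summable_xor
  (summable_term (qf_and qA qB) q0 HP b0 am)
  (summable_term (qf_and qA (qf_neg qB)) q0 HP (ltn0Sn 0) al)) => y j.
have := HB y j; rewrite -!andbA mul1n => ->.
by case: (A y); case: (P j); case: (B y); rewrite //= ?addbF.
Qed.

(** With g = (1 + X^w) f one has f = g + X^w g + X^(2w) g + ..., since the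
    iterated translates of f eventually vanish at every point; that is, f(y) is
    the parity of the number of j such that g(y - jw), and only the j up to the
    coordinate y_i0 matter. *)
Lemma qf_integrate w i0 f : (0 < w i0)%N ->
  (forall x, x i0 < 0 -> f x = false) ->
  qf (fun x => f x (+) f (translate (fun i => (w i)%:Z) x)) -> qf f.
Proof.
move=> w0 f0 qg; set g := (fun x => _) in qg.
have [s [qs Hs]] := summable_step (step_move_back w qg) (aff_var i0).
apply: qf_ext qs => y; have [M HM] := Hs y.
pose N := maxn M (`|y i0|%N).+1.
rewrite -(HM N) ?leq_maxl //.
have out j : (`|y i0| < j)%N -> f (move_back w y j) = false.
  by move=> yj; apply: f0; rewrite /move_back; nia.
have -> : \big[addb/false]_(j < N) (g (move_back w y j) && (j%:Z <= y i0)) =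
    \big[addb/false]_(j < N) (f (move_back w y j) (+) f (move_back w y j.+1)).
  apply: eq_bigr => j _; rewrite /g.
  have -> : translate (fun i => (w i)%:Z) (move_back w y j) = move_back w y j.+1.
    by apply: funext => i; rewrite /translate /move_back; lia.
  case: lerP => [|yj]; rewrite ?andbT ?andbF //.
  by rewrite !f0 // /move_back; nia.
have -> n : \big[addb/false]_(j < n) (f (move_back w y j) (+) f (move_back w y j.+1)) =
    f y (+) f (move_back w y n).
  elim: n => [|n IH].
    rewrite big_ord0 (_ : move_back w y 0 = y) ?addbb //.
    by apply: funext => i; rewrite /move_back mul0n subr0.
  by rewrite big_ord_recr /= IH addbA -[X in X (+) _]addbA addbb addbF.
by rewrite out ?addbF //; lia.
Qed.

End Summation.

(** Quantifier-free definability, for sets of vectors of natural numbers. *)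
Definition presburger d (X : ('I_d -> nat) -> Prop) :=
  exists g, qf g /\ forall x, X x <-> g (fun i => (x i)%:Z).

Definition norm d (x : 'I_d -> nat) : nat := (\sum_(i <- enum 'I_d) x i)%N.

Definition locally_periodic d (X : ('I_d -> nat) -> Prop) := exists K, forall k,
  exists l, forall x : 'I_d -> nat, (l <= norm x)%N ->
  exists w : 'I_d -> nat, [/\ forall i, (w i <= K)%N, (0 < norm w)%N
  & forall y : 'I_d -> nat, (forall i, (y i <= k)%N) ->
    (X (fun i => x i + y i)%N <-> X (fun i => x i + y i + w i)%N)].

Lemma qf_forall I n (f : 'I_n -> (I -> int) -> bool) : (forall r, qf (f r)) ->
  qf (fun x => [forall r, f r x]).
Proof.
move=> qff; have H (s : seq 'I_n) : qf (fun x => all (fun r => f r x) s).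
  elim: s => [|r s IH]; first exact: qf_const.
  exact: (qf_and (qff r) IH).
apply: qf_ext (H (enum 'I_n)) => x.
by apply/allP/forallP => [K r|K r _ //]; apply: K; rewrite mem_enum.
Qed.

Section LocallyPeriodic.
Variable d : nat.
Notation D := d.+1.
Implicit Types (G : ('I_D -> int) -> bool) (x z : 'I_D -> int) (w : 'I_D -> nat).

(** Multiplication by the binomial 1 + X^w of power series over the field with
    two elements. *)
Definition nabla w G := fun x => G x (+) G (translate (fun i => (w i)%:Z) x).

Definition nablas K (s : seq {ffun 'I_D -> 'I_K.+1}) G :=
  foldr (fun u : {ffun 'I_D -> 'I_K.+1} => nabla (fun i => u i)) G s.

Definition supported G := forall x i, x i < 0 -> G x = false.

Lemma supported_nablas K (s : seq {ffun 'I_D -> 'I_K.+1}) G :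
  supported G -> supported (nablas s G).
Proof.
move=> sG; elim: s => //= u s IH x i xi; rewrite /nabla (IH _ _ xi).
by rewrite (IH _ i) // /translate; lia.
Qed.

Lemma qf_nablas K (s : seq {ffun 'I_D -> 'I_K.+1}) G : supported G ->
  (forall u, u \in s -> exists i, 0 < u i)%N -> qf (nablas s G) -> qf G.
Proof.
move=> sG; elim: s => //= u s IH nz q; apply: IH.
  by move=> v vs; apply: nz; rewrite inE vs orbT.
have [i ui] := nz u (mem_head _ _).
apply: (@qf_integrate _ (fun i => u i) i _ ui _ q) => x.
exact: supported_nablas.
Qed.

Definition box K x n z := forall i, x i - (n * K)%:Z <= z i <= x i.

Lemma box_translate K x n z (u : {ffun 'I_D -> 'I_K.+1}) : box K x n z ->
  box K x n.+1 (translate (fun i => (u i : nat)%:Z) z).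
Proof. by move=> H i; have := H i; have := ltn_ord (u i); rewrite /translate mulSn; lia. Qed.

Lemma boxW K x n z : box K x n z -> box K x n.+1 z.
Proof. by move=> H i; have := H i; rewrite mulSn; lia. Qed.

Lemma nablas_periodic K x w (s : seq {ffun 'I_D -> 'I_K.+1}) G n :
  (forall z, box K x (n + size s) z -> G z = G (translate (fun i => (w i)%:Z) z)) ->
  forall z, box K x n z ->
    nablas s G z = nablas s G (translate (fun i => (w i)%:Z) z).
Proof.
elim: s n => [|u s IH] n /=; first by rewrite addn0.
rewrite addnS -addSn => /IH H z bz; rewrite /nabla (H _ (boxW bz)).
rewrite (H _ (box_translate u bz)); congr (_ (+) nablas s G _).
by apply: funext => i; rewrite /translate addrAC.
Qed.

(** Multiplication by 1 + X^u kills [G] where it is invariant under u, and every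
    other factor looks at points at most K further down in each coordinate,
    whence the shrinking boxes. *)
Lemma nablas_zero K x (u : {ffun 'I_D -> 'I_K.+1}) (s : seq {ffun 'I_D -> 'I_K.+1}) G n :
  u \in s ->
  (forall z, box K x (n + size s) z -> G z = G (translate (fun i => (u i : nat)%:Z) z)) ->
  forall z, box K x n z -> nablas s G z = false.
Proof.
elim: s n => [//|v s IH] n; rewrite inE => us HG z bz.
move: HG; rewrite /= addnS -addSn => HG; case/predU1P: us => [uv|us].
  have H := nablas_periodic HG (boxW bz).
  by rewrite /nabla -uv -H addbb.
have H := IH _ us HG.
by rewrite /nabla (H _ (boxW bz)) (H _ (box_translate v bz)).
Qed.

Definition qf_sections G := forall i (c : int), qf (fun x => G x && (x i == c)).

Lemma qf_sections_nablas K (s : seq {ffun 'I_D -> 'I_K.+1}) G :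
  qf_sections G -> qf_sections (nablas s G).
Proof.
move=> qG; elim: s => //= u s IH i c.
apply: qf_ext (qf_xor (IH i c) (qf_translate (fun i => (u i : nat)%:Z)
  (IH i (c - (u i : nat)%:Z)))) => x.
rewrite /nabla andb_addl; congr (_ (+) (_ && _)).
by rewrite /translate; apply/eqP/eqP; lia.
Qed.

Lemma qf_slabs G (s : seq ('I_D * int)) : qf_sections G ->
  qf (fun x => G x && has (fun p => x p.1 == p.2) s).
Proof.
move=> qG; elim: s => [|[i c] s IH] /=.
  by apply: qf_ext (qf_const _ false) => x; rewrite andbF.
have qe : qf (fun x : 'I_D -> int => x i == c).
  by apply: qf_eq; [exact: aff_var|exact: aff_const].
apply: qf_ext (qf_xor (qG i c) (qf_and (qf_neg qe) IH)) => x.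
by case: (G x); case: (x i == c); case: has.
Qed.

(** Muchnik's criterion in a form with nonnegative periods: apply
    [qf_nablas] to the product by all binomials 1 + X^w with w nonzero and
    bounded by K.  By [nablas_zero] this product vanishes unless some coordinate
    is less than a constant B, and on each hyperplane x_i = c it is
    quantifier-free by hypothesis on the sections. *)
Lemma presburger_of_locally_periodic (X : ('I_D -> nat) -> Prop) : locally_periodic X ->
  (forall i e, presburger (fun v => X (insert_coord i e v))) -> presburger X.
Proof.
move=> [K XK] secX.
pose F x := [forall i, 0 <= x i] && `[< X (fun i => `|x i|%N) >].
have F_nat (x : 'I_D -> nat) : F (fun i => (x i)%:Z) = `[< X x >].
  by rewrite /F (_ : [forall i, _]) //; apply/forallP.
suff qF : qf F by exists F; split=> // x; rewrite F_nat; split=> [/asboolP|/asboolP].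
have sF : supported F.
  by move=> x i xi; apply/negbTE/negP => /andP[/forallP/(_ i)]; lia.
have secF : qf_sections F.
  move=> i [e|e]; last first.
    apply: qf_ext (qf_const _ false) => x; apply/esym/negbTE/negP => /andP[Fx /eqP xi].
    by have := sF x i; rewrite Fx xi => /(_ isT).
  have [g [qg Hg]] := secX i e.
  have q1 : qf (fun x : 'I_D -> int => [forall i, 0 <= x i]).
    by apply: qf_forall => r; apply: qf_ge; exact: aff_var.
  have q2 : qf (fun x : 'I_D -> int => x i == e).
    by apply: qf_eq; [exact: aff_var|exact: aff_const].
  have q3 : qf (fun x : 'I_D -> int => g (fun j => x (lift i j))).
    by apply: qf_comp qg => j; exact: aff_var.
  apply: qf_ext (qf_and (qf_and q1 q3) q2) => x; rewrite /F.
  case: forallP => //= x0; case: eqP => xi; rewrite ?andbF // !andbT.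
  rewrite (insert_coord_eta i (fun i => `|x i|%N)) xi /=.
  have := Hg (fun j => `|x (lift i j)|%N).
  have -> : (fun j => `|x (lift i j)|%N%:Z) = (fun j => x (lift i j)).
    by apply: funext => j; rewrite gez0_abs.
  by move=> H; apply/idP/asboolP => /H.
pose s := [seq u : {ffun 'I_D -> 'I_K.+1} <- enum {ffun 'I_D -> 'I_K.+1} |
  [exists i, (0 < u i)%N]].
apply: (@qf_nablas K s) => // [u|]; first by rewrite mem_filter => /andP[/existsP].
(* the product looks back by (size s) K, and one more K is needed for z - w *)
pose k := ((size s).+1 * K)%N; have [l Hl] := XK k.
pose B := (k + l)%N.
pose slabs := [seq (i, c%:Z) | i <- enum 'I_D, c <- iota 0 B].
apply: qf_ext (qf_slabs slabs (qf_sections_nablas s secF)) => x.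
case Tx : (nablas s F x) => //=.
have x0 i : 0 <= x i.
  rewrite leNgt; apply/negP => xi.
  by have := @supported_nablas K s F sF x i xi; rewrite Tx.
apply/hasP; apply: contrapT => nslab.
have xB i : B%:Z <= x i.
  rewrite leNgt; apply/negP => xi; apply: nslab; exists (i, x i) => //=.
  apply/allpairsP; exists (i, `|x i|%N); split; rewrite ?mem_enum ?mem_iota //=.
    by have := x0 i; lia.
  by rewrite gez0_abs.
pose y i := (`|x i| - k)%N.
have xy i : x i = (y i + k)%:Z.
  by rewrite /y; have := xB i; rewrite /B; lia.
have [|w [wK w0 Hw]] := Hl y.
  rewrite /norm (bigD1_seq ord0) ?mem_enum ?enum_uniq //= (leq_trans _ (leq_addr _ _)) //.
  by have := xB ord0; rewrite xy /B; lia.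
have wK' i : (w i < K.+1)%N by rewrite ltnS.
pose u := [ffun i => Ordinal (wK' i)].
have us : u \in s.
  rewrite mem_filter mem_enum andbT; apply/existsP; apply: contrapT => nu.
  move: w0; rewrite /norm big1_seq // => i _; apply/eqP; rewrite -leqn0 leqNgt.
  by apply/negP => wi; apply: nu; exists i; rewrite ffunE.
suff : nablas s F x = false by rewrite Tx.
apply: (@nablas_zero K x u s F 0 us) => [z|i]; last by lia.
rewrite add0n => bz.
pose t i := absz (z i - (w i)%:Z - (y i)%:Z)%R.
have zt i : z i = (y i + t i + w i)%N%:Z /\ (t i <= k)%N.
  have := bz i; have := wK i; rewrite xy /t /k mulSn; split; lia.
have -> : z = (fun i => (y i + t i + w i)%N%:Z) by apply: funext => i; case: (zt i).
rewrite (_ : translate _ _ = (fun i => (y i + t i)%N%:Z)); last first.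
  by apply: funext => i; rewrite /translate ffunE /=; lia.
rewrite !F_nat; have H := Hw t (fun i => (zt i).2).
by apply/asboolP/asboolP => /H.
Qed.

End LocallyPeriodic.
End QuantifierFree.

(** * Local periodicity is forced *)

Section Select.
Variables (d : nat) (X : ('I_d -> nat) -> Prop).
Implicit Types x y w : 'I_d -> nat.

(** Counterexamples to [locally_periodic] for [K] and [k]. *)
Definition aperiodic K k x := forall w, (forall i, w i <= K) -> 0 < norm w ->
  exists y, (forall i, y i <= k) /\
    ~ (X (fun i => x i + y i) <-> X (fun i => x i + y i + w i)).

Definition closest K k l x := aperiodic K k x /\ (l <= norm x /\
  forall x', aperiodic K k x' -> l <= norm x' -> norm x <= norm x').

Definition lex_before x x' := (forall i, x i = x' i) \/
  exists i : 'I_d, x i < x' i /\ forall j : 'I_d, j < i -> x j = x' j.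

(** A definable choice among the closest points. *)
Definition selected K k l x := closest K k l x /\
  forall x', closest K k l x' -> lex_before x x'.

Lemma ex_lex_first (Q : ('I_d -> nat) -> Prop) : (exists x, Q x) ->
  exists x, Q x /\ forall x', Q x' -> lex_before x x'.
Proof.
move=> exQ.
suff H m : m <= d -> exists x, Q x /\ forall x', Q x' ->
    (forall i : 'I_d, i < m -> x i = x' i) \/
    exists i : 'I_d, x i < x' i /\ forall j : 'I_d, j < i -> x j = x' j.
  have [x [Qx xmin]] := H d (leqnn d); exists x; split=> // x' /xmin[E|]; last by right.
  by left=> i; apply: E.
elim: m => [_|m IH md]; first by have [x Qx] := exQ; exists x; split=> // x' _; left.
have [x [Qx xmin]] := IH (ltnW md); pose im := Ordinal md.
have [|v [[z [Qz xz <-]] zmin]] := @ex_least (fun v => exists z,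
    [/\ Q z, forall i : 'I_d, i < m -> x i = z i & z im = v]).
  by exists (x im), x.
exists z; split=> // x' Qx'; case: (xmin _ Qx') => [E|[i [xi E]]].
  have := zmin (x' im); case/(_ _)/Wrap => [|]; first by exists x'.
  rewrite leq_eqVlt => /predU1P[e|lt]; last first.
    by right; exists im; split=> // j jm; rewrite -xz ?E.
  left=> i; rewrite ltnS leq_eqVlt => /predU1P[im'|lim]; last by rewrite -xz ?E.
  by have -> : i = im by apply: val_inj.
case: (ltnP i m) => im'.
  right; exists i; split=> [|j ji]; first by rewrite -xz.
  by rewrite -xz ?E //; lia.
have := zmin (x' im); case/(_ _)/Wrap => [|]; first by exists x'; split=> // j jm; apply: E; lia.
rewrite leq_eqVlt => /predU1P[e|lt]; last first.
  by right; exists im; split=> // j jm; rewrite -xz ?E //; move: jm => /=; lia.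
left=> j; rewrite ltnS leq_eqVlt => /predU1P[jm|ljm]; last by rewrite -xz ?E //; lia.
by have -> : j = im by apply: val_inj.
Qed.

Lemma lex_before_anti x x' : lex_before x x' -> lex_before x' x -> x = x'.
Proof.
move=> [E _|[i [xi Ei]]]; first exact: funext.
case=> [E|[j [xj Ej]]]; first by rewrite E ltnn in xi.
case: (ltngtP i j) => ij.
- by have := Ej _ ij; lia.
- by have := Ei _ ij; lia.
- by move: xi xj; rewrite (val_inj ij); lia.
Qed.

Lemma selected_unique K k l x x' : selected K k l x -> selected K k l x' -> x = x'.
Proof. by move=> [cx Hx] [cx' Hx']; apply: lex_before_anti; [apply: Hx|apply: Hx']. Qed.

Lemma ex_selected K k l : (exists x, l <= norm x /\ aperiodic K k x) ->
  exists x, selected K k l x.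
Proof.
move=> [x0 [lx0 ax0]]; apply: ex_lex_first.
have [|n [[x [lx ax <-]] xmin]] := @ex_least (fun n => exists x,
    [/\ l <= norm x, aperiodic K k x & norm x = n]); first by exists (norm x0), x0.
by exists x; split=> //; split=> // x' ax' lx'; apply: xmin; exists x'.
Qed.

Lemma ultimate_period_multiples p A : 0 < p -> ultimate_period p A -> exists j0,
  (forall j, j0 <= j -> A (j * p)) \/ (forall j, j0 <= j -> ~ A (j * p)).
Proof.
move=> p0 [t H]; exists t.
have E n : A ((t + n) * p) <-> A (t * p).
  elim: n => [|n IH]; first by rewrite addn0.
  by rewrite -IH addnS mulSn addnC -H //; nia.
case: (pselect (A (t * p))) => At; [left|right] => j tj; by rewrite -(subnKC tj) E.
Qed.

Lemma leq_norm x i : x i <= norm x.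
Proof. by rewrite /norm (bigD1_seq i) ?mem_enum ?enum_uniq //= leq_addr. Qed.

(** Assume that local periodicity fails with K = p, for some k, and let x_l be
    the selected points.  The first hypothesis makes the norms of aperiodic
    points ultimately p-periodic, so the norm of x_l is at most l + p for l large.
    Therefore, with the third hypothesis, the coordinates of x_(l+p) - x_l, for l a
    large multiple of p, are eventually all nonnegative (they cannot decrease
    forever) and at most p (otherwise a coordinate would grow faster than the norm).
    By the second hypothesis the set looks the same around x_l and x_(l+p), so
    this difference, when nonzero, is a period that contradicts the choice of
    x_l. *)
Lemma locally_periodic_of_ultimate_period p : 0 < p ->
  (forall K k, ultimate_period p (fun n => exists x, aperiodic K k x /\ norm x = n)) ->
  (forall K k y, ultimate_period p (fun l => exists x, selected K k l x /\ X (fun i => x i + y i))) ->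
  (forall K k q (j : nat) a b, ultimate_period p (fun l => exists x x', selected K k l x /\
     (selected K k (l + q) x' /\ forall i : 'I_d, j = i :> nat -> x' i + a <= x i + b))) ->
  locally_periodic X.
Proof.
move=> p0 H0 H1 H2; exists p => k; apply: contrapT => nP.
have exx l : exists x, selected p k l x.
  apply: ex_selected; apply: contrapT => nx; apply: nP; exists l => x lx.
  apply: contrapT => K; apply: nx; exists x; split=> // w wp w0.
  apply: contrapT => K'; apply: K; exists w; split=> // y yk.
  by apply: contrapT => K''; apply: K'; exists y.
have [xs Hxs] := choice exx.
have xsE l x : selected p k l x -> x = xs l by move=> Hx; exact: selected_unique (Hxs l).
have lower l : l <= norm (xs l) by have [[_ []]] := Hxs l.
have [t0 upper] : exists t0, forall l, t0 <= l -> norm (xs l) <= l + p.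
  have [t Ht] := H0 p k; exists (norm (xs t)) => l tl.
  have Hn j : exists x, aperiodic p k x /\ norm x = norm (xs t) + j * p.
    elim: j => [|j IH]; first by exists (xs t); rewrite addn0; split=> //; case: (Hxs t) => -[].
    have tj : t <= norm (xs t) + j * p by rewrite (leq_trans (lower t)) ?leq_addr.
    by rewrite mulSn [p + _]addnC addnA; apply/(Ht _ tj).
  pose j := ((l - norm (xs t)) %/ p).+1.
  have [x [ax nx]] := Hn j; have [[_ [_ xmin]] _] := Hxs l.
  have := divn_eq (l - norm (xs t)) p; have := ltn_pmod (l - norm (xs t)) p0.
  move: nx; rewrite /j mulSn => nx Hm Hd.
  by have := xmin x ax; lia.
pose a i j := xs (j * p) i.
have aS i j : a i j.+1 = xs (j * p + p) i by rewrite /a mulSn addnC.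
have upper_a i j : t0 <= j -> a i j <= j * p + p.
  move=> tj; apply: leq_trans (leq_norm _ _) (upper _ _).
  by apply: leq_trans tj _; rewrite leq_pmulr.
have step_a i : exists J, forall j, J <= j -> a i j <= a i j.+1 <= a i j + p.
  have evp b c : exists j0, (forall j, j0 <= j -> a i j.+1 + b <= a i j + c) \/
      (forall j, j0 <= j -> ~ a i j.+1 + b <= a i j + c).
    have E l : (exists x x', selected p k l x /\ (selected p k (l + p) x' /\
        forall i' : 'I_d, i = i' :> nat -> x' i' + b <= x i' + c)) <->
        xs (l + p) i + b <= xs l i + c.
      split=> [[x [x' [/xsE-> [/xsE-> H]]]]|H]; first exact: H.
      by exists (xs l), (xs (l + p)); do 2!split=> //; move=> i' /val_inj <-.
    have [j0 Hj] := ultimate_period_multiples p0 (H2 p k p i b c).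
    exists j0; case: Hj => Hj; [left|right] => j ij; have /= := Hj j ij.
      by move=> /E; rewrite aS.
    by move=> nE; rewrite aS => aE; apply: nE; apply/E.
  have [j1 Hj1] : exists J, forall j, J <= j -> a i j.+1 + 0 <= a i j + p.
    have [j0 [H|H]] := evp 0 p; first by exists j0.
    have grow n : n * p.+1 <= a i (j0 + n).
      elim: n => [//|n IH]; have := H (j0 + n) (leq_addr _ _).
      by rewrite addnS mulSn; lia.
    pose n := t0 + j0 * p + p + 1.
    have tn : t0 <= j0 + n by rewrite /n; lia.
    have := grow n; have := upper_a i _ tn; rewrite mulnS mulnDl.
    have : j0 * p + p < n by rewrite /n; lia.
    lia.
  have [j2 Hj2] : exists J, forall j, J <= j -> ~ a i j.+1 + 1 <= a i j + 0.
    have [j0 [H|H]] := evp 1 0; last by exists j0.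
    have fall n : a i (j0 + n) + n <= a i j0.
      elim: n => [|n IH]; first by rewrite !addn0.
      by have := H (j0 + n) (leq_addr _ _); rewrite !addnS; lia.
    by have := fall (a i j0).+1; lia.
  by exists (maxn j1 j2) => j jm; have := Hj1 j; have := Hj2 j; lia.
have [J HJ] := uniform_bound (fun i m n mn H j nj => H j (leq_trans mn nj)) step_a.
have [||J' HJ'] := @uniform_bound {ffun 'I_d -> 'I_k.+1}
  (fun (y : {ffun 'I_d -> 'I_k.+1}) J => forall j, J <= j ->
    (X (fun i => a i j + y i) <-> X (fun i => a i j.+1 + y i))).
- by move=> y m n mn H j nj; apply: H; exact: leq_trans mn nj.
- move=> y; have [t Ht] := H1 p k (fun i => y i); exists t => j tj.
  have E l : (exists x, selected p k l x /\ X (fun i => x i + y i)) <->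
      X (fun i => xs l i + y i).
    by split=> [[x [/xsE-> //]]|H]; exists (xs l).
  have tj' : t <= j * p by apply: leq_trans tj _; rewrite leq_pmulr.
  have -> : (fun i => a i j.+1 + y i) = (fun i => xs (j * p + p) i + y i).
    by apply: funext => i; rewrite aS.
  by apply: (iff_trans (iff_sym (E _))); apply: iff_trans (Ht _ tj') (E _).
have [j [Jj neq]] : exists j, maxn J J' <= j /\ exists i, a i j <> a i j.+1.
  apply: contrapT => H; pose M := maxn J J'.
  have cst n : xs ((M + n) * p) = xs (M * p).
    elim: n => [|n IH]; first by rewrite addn0.
    rewrite -{}IH addnS; apply: funext => i; apply: contrapT => ne; apply: H.
    by exists (M + n); rewrite leq_addr; split=> //; exists i => e; apply: ne; rewrite /a in e.
  by have := lower ((M + (norm (xs (M * p))).+1) * p); rewrite cst; nia.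
pose w i := a i j.+1 - a i j.
have HJj i : a i j <= a i j.+1 <= a i j + p by apply: HJ; lia.
have [[ap _] _] := Hxs (j * p).
have [||y [yk Hy]] := ap w.
- by move=> i; rewrite /w; have := HJj i; lia.
- by case: neq => i ne; apply: leq_trans (leq_norm _ i); rewrite /w; have := HJj i; lia.
have yk' i : y i < k.+1 by rewrite ltnS.
apply: Hy; have jJ' : J' <= j by lia.
have := HJ' [ffun i => Ordinal (yk' i)] j jJ'.
have -> : (fun i => xs (j * p) i + y i + w i) = (fun i => a i j.+1 + y i).
  by apply: funext => i; rewrite /w -/(a i j); have := HJj i; lia.
have E v : (fun i => v i + [ffun i => Ordinal (yk' i)] i) = (fun i => v i + y i).
  by apply: funext => i; rewrite ffunE.
by rewrite !E.
Qed.

End Select.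

Section LocalPeriodicity.
Variable V : vocabulary.
Implicit Types psi : structure V -> env -> Prop.

(** The three families of [locally_periodic_of_ultimate_period] are expressible, with
    K, k and the other numbers as parameters; a common period of all of them is
    the product of their three common periods. *)
Lemma forced_locally_periodic d psi : expressible psi ->
  forced (fun S r => locally_periodic (fun x : 'I_d -> nat => psi S (vapp x r))).
Proof.
move=> dpsi.
pose X S (r : env) := fun x : 'I_d -> nat => psi S (vapp x r).
(* variables 0, 1, 2 hold the argument, K and k; then come y or q, j, a, b *)
pose P0 S (r : env) := exists x : 'I_d -> nat,
  aperiodic (X S (fun k => r k.+3)) (r 1) (r 2) x /\ norm x = r 0.
have dP0 : expressible P0 by rewrite /P0 /aperiodic /norm /X; solve_expressible.
pose P1 S (r : env) := exists x : 'I_d -> nat,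
  selected (X S (fun k => r (d + k).+3)) (r 1) (r 2) (r 0) x /\
  X S (fun k => r (d + k).+3) (fun i => x i + r i.+3).
have dP1 : expressible P1.
  by rewrite /P1 /selected /closest /lex_before /aperiodic /norm /X; solve_expressible.
pose P2 S (r : env) := exists x x' : 'I_d -> nat,
  selected (X S (fun k => r k.+4.+3)) (r 1) (r 2) (r 0) x /\
  (selected (X S (fun k => r k.+4.+3)) (r 1) (r 2) (r 0 + r 3) x' /\
   forall i : 'I_d, r 4 = i :> nat -> x' i + r 5 <= x i + r 6).
have dP2 : expressible P2.
  by rewrite /P2 /selected /closest /lex_before /aperiodic /norm /X; solve_expressible.
apply: forced_imp (forced_and (forced_uniform_ultimate_period dP0)
  (forced_and (forced_uniform_ultimate_period dP1) (forced_uniform_ultimate_period dP2))) => S r.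
move=> [[p0 [p0_gt0 H0]] [[p1 [p1_gt0 H1]] [p2 [p2_gt0 H2]]]].
apply: (@locally_periodic_of_ultimate_period _ (X S r) (p0 * p1 * p2)).
- by rewrite !muln_gt0 p0_gt0 p1_gt0.
- move=> K k; rewrite -mulnA mulnC; apply: ultimate_period_mul.
  exact: (H0 (K .: (k .: r))).
- move=> K k y; rewrite mulnAC; apply: ultimate_period_mul.
  have := H1 (K .: (k .: vapp y r)); congr ultimate_period; apply: funext => l.
  rewrite /unary /P1 /= (_ : (fun k => vapp y r (d + k)) = r); last first.
    by apply: funext => j; rewrite vappR.
  apply: eq_exists => x; congr (_ /\ X S r _); apply: funext => i.
  by rewrite vappL.
- move=> K k q j a b; apply: ultimate_period_mul.
  exact: (H2 (K .: (k .: (q .: (j .: (a .: (b .: r))))))).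
Qed.

End LocalPeriodicity.

(** * Induction on the dimension *)

Section Induction.
Variable V : vocabulary.
Implicit Types psi : structure V -> env -> Prop.

Lemma expressible_insert_coord d (h : 'I_d.+1) (f : env -> nat) (x : env -> 'I_d -> nat) :
  expressible_fun V f -> (forall i, expressible_fun V (fun r => x r i)) ->
  forall i, expressible_fun V (fun r => insert_coord h (f r) (x r) i).
Proof. by move=> df dx i; rewrite /insert_coord; case: unlift. Qed.

(** The sections x_i = e are sets of smaller dimension with the additional
    parameter e. *)
Lemma forced_presburger d psi : expressible psi ->
  forced (fun S r => presburger (fun x : 'I_d -> nat => psi S (vapp x r))).
Proof.
elim: d psi => [|d IH] psi dpsi.
  apply: forced_triv => S r; exists (fun=> `[< psi S (vapp (fun _ : 'I_0 => 0) r) >]).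
  split; first exact: qf_const.
  move=> x; rewrite (_ : x = fun=> 0); first by split=> /asboolP.
  by apply: funext => -[].
have sec i : forced (fun S r => forall e,
    presburger (fun z : 'I_d -> nat => psi S (vapp (insert_coord i e z) r))).
  pose psi_i S (r : env) := psi S (vapp (insert_coord i (r d) (fun k => r k))
    (fun k => r (d + k.+1))).
  have dpsi_i : expressible psi_i.
    rewrite /psi_i; apply: (expressible_app dpsi); apply: expressible_vapp.
      by apply: expressible_insert_coord => *; apply: expressible_var.
    by move=> k; apply: expressible_var.
  apply: forced_imp (forced_all (IH _ dpsi_i)) => S r H e.
  have := H e; congr presburger; apply: funext => z; rewrite /psi_i.
  congr (psi S (vapp (insert_coord i _ _) _)).
  - by have := vappR z (e .: r) 0; rewrite addn0.
  - by apply: funext => k; rewrite vappL.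
  - by apply: funext => k; rewrite vappR.
apply: forced_imp (forced_and (forced_locally_periodic d.+1 dpsi)
  (forced_fin_all sec)) => S r [H1 H2].
exact: presburger_of_locally_periodic.
Qed.

Lemma aff_expressible d (l : ('I_d -> int) -> int) : aff l ->
  exists p n : env -> nat, [/\ expressible_fun V p, expressible_fun V n &
    forall r : env, (l (fun i => (r i)%:Z) = (p r)%:Z - (n r)%:Z)%R].
Proof.
elim=> {l} [i|c|l m _ [p [n [dp dn lE]]] _ [p' [n' [dp' dn' mE]]]|a l _ [p [n [dp dn lE]]]].
- exists (fun r => r i), (fun=> 0).
  by split=> [||r]; [exact: expressible_var|exact: expressible_const|rewrite GRing.subr0].
- by case: c => c; [exists (fun=> c), (fun=> 0)|exists (fun=> 0), (fun=> c.+1)];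
    split=> [||r]; try exact: expressible_const; lia.
- exists (fun r => p r + p' r), (fun r => n r + n' r).
  by split=> [||r]; [exact: expressible_add|exact: expressible_add|rewrite lE mE; lia].
- case: a => a.
    exists (fun r => a * p r), (fun r => a * n r).
    by split=> [||r]; [exact: expressible_mul|exact: expressible_mul|rewrite lE; lia].
  exists (fun r => a.+1 * n r), (fun r => a.+1 * p r).
  by split=> [||r]; [exact: expressible_mul|exact: expressible_mul|rewrite lE; lia].
Qed.

Lemma qf_expressible d (g : ('I_d -> int) -> bool) : qf g ->
  expressible (fun (S : structure V) (r : env) => g (fun i => Posz (r i))).
Proof.
elim=> {g} [l al|q l q0 al|b|f g _ IH1 _ IH2|f g _ IH1 _ IH2].
- have [p [n [dp dn lE]]] := aff_expressible al.
  apply: (@expressible_ext _ (fun S r => n r <= p r)); last exact: expressible_le.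
  by move=> S r; rewrite lE; lia.
- have [p [n [dp dn lE]]] := aff_expressible al.
  apply: (@expressible_ext _ (fun S r => exists z, p r = n r + q * z \/ n r = p r + q * z)).
    move=> S r; rewrite lE; split.
      move=> [z [->|->]]; apply/dvdzP; [exists (Posz z)|exists (- Posz z)%R]; lia.
    move/dvdzP => [[z|z] E]; [exists z|exists z.+1]; lia.
  apply: expressible_ex; apply: expressible_or; apply: expressible_eq;
    try apply: expressible_add; try (by apply: expressible_shift);
    by apply: expressible_mul; apply: expressible_var.
- exact: expressible_true.
- apply: expressible_ext (expressible_not (expressible_iff IH1 IH2)) => S r.
  move: (f _) (g _) => [] []; split=> // H;
    solve [by case: H | by case=> /(_ isT) | by case=> _ /(_ isT)].
- apply: expressible_ext (expressible_and IH1 IH2) => S r.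
  by split=> [[-> ->]|/andP].
Qed.

(** The variables of index larger than [d] are identified with variable 0, as a
    formula with [d.+1] free variables cannot mention them. *)
Lemma expressible_formula d P : expressible P -> exists phi : formula V d.+1,
  forall S v, sat S v phi <-> P S (fun k => tnth v (inord k)).
Proof.
move=> [N [phi phiP]]; exists (ren (fun i : 'I_N => inord i) phi) => S v.
rewrite sat_ren phiP; set t := pull _ _; set t' := prefix_tuple _ _.
by have -> : t = t' by apply: eq_from_tnth => i; rewrite !tnth_mktuple.
Qed.

End Induction.

Lemma presburger_FO_definable d (A : set (d.+1.-tuple nat)) :
  presburger (fun x : 'I_d.+1 -> nat => A [tuple x i | i < d.+1]) ->
  FO_plus_lt_definable A.
Proof.
move=> [g [qg Hg]].
have [phi Hphi] := expressible_formula d (qf_expressible plus_lt qg).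
exists phi; apply: funext => v; apply: propext; rewrite /defined_set /=.
rewrite Hphi -(Hg (fun i => tnth v (inord i))).
rewrite (_ : [tuple _ | _ < _] = v) //.
by apply: eq_from_tnth => i; rewrite tnth_mktuple inord_val.
Qed.

Theorem corollary4p9 (d : nat) (hd : 1 <= d) :
  exists nu : formula (plus_lt_rel d) 1,
    forall S : structure (plus_lt_rel d),
      ~ FO_plus_lt_definable (S tt) ->
      expanding (defined_set1 S nu).
Proof.
case: d hd => // d _; pose V := plus_lt_rel d.+1.
pose psi (S : structure V) (r : env) := S tt (prefix_tuple r d.+1).
have dpsi : expressible psi.
  exists d.+1, (@Rel V d.+1 tt [tuple Var i | i < d.+1]) => S r /=.
  rewrite /psi (_ : map_tuple _ _ = prefix_tuple r d.+1) //.
  by apply: eq_from_tnth => i; rewrite tnth_map tnth_mktuple.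
have [A [dA HA]] := forced_presburger d.+1 dpsi.
(* the property has no parameters, so those of A may be set to 0 *)
have dA0 : expressible (fun S r => A S (r 0 .: (fun=> 0))) by solve_expressible.
have [nu Hnu] := expressible_formula 0 dA0.
exists nu => S nD.
rewrite (_ : defined_set1 S nu = unary A S (fun=> 0)).
  apply: HA => qf_R; apply: nD; apply: presburger_FO_definable.
  move: qf_R; congr presburger; apply: funext => x; rewrite /psi; congr (S tt _).
  by apply: eq_from_tnth => i; rewrite !tnth_mktuple vappL.
apply: funext => x; apply: propext.
by rewrite /defined_set1 /defined_set /= Hnu /unary (tnth_nth 0) inordK.
Qed.
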